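(* Let $0<\alpha<n$ and $\gamma\ge 0$. Let $1\le p_1<\frac{n}{\alpha}$ and let $s,t$ satisfy one of the following: (a) $1\le s<t=\frac{n}{n-\alpha}$ (allowed for every $\gamma\ge 0$); or (b) $\gamma>0$, $1\le s\le t$ and $\frac{n}{n+\gamma-\alpha}<t<\frac{n}{n-\alpha}$. Define $p_2$ by $\frac{1}{p_2}=\frac{1}{p_1}-\frac{1}{s'}$. Let $\phi:\mathbb{R}^{+}\to\mathbb{R}^{+}$ be of class $\mathcal{G}_{p_1}$ and suppose there is a constant $C_0>0$ such that $$\int_R^\infty \phi(r)\,r^{\frac{n}{t'}-1}\,dr\le C_0\,\phi(R)\,R^{\frac{n}{t'}}\quad\text{for every } R>0.$$ Put $\psi(r):=\phi(r)\,r^{\frac{n}{t'}}$ for $r>0$. Then $I_{\alpha,\gamma}$ is bounded from $L^{p_1,\phi}(\mathbb{R}^n)$ to $L^{p_2,\psi}(\mathbb{R}^n)$, and there is a constant $C>0$, independent of $f$, such that $$\|I_{\alpha,\gamma}f\|_{L^{p_2,\psi}}\le C\,\|K_{\alpha,\gamma}\|_{L^{s,t}}\,\|f\|_{L^{p_1,\phi}}\quad\text{for all } f\in L^{p_1,\phi}(\mathbb{R}^n).$$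
   Context: Bessel-Riesz kernel and operator: for $0<\alpha<n$ and $\gamma\ge 0$, $K_{\alpha,\gamma}(x):=\frac{|x|^{\alpha-n}}{(1+|x|)^{\gamma}}$ on $\mathbb{R}^n$, and $I_{\alpha,\gamma}f(x):=\int_{\mathbb{R}^n}K_{\alpha,\gamma}(x-y)f(y)\,dy$. Class $\mathcal{G}_p$ ($1\le p<\infty$): $\phi:\mathbb{R}^+\to\mathbb{R}^+$ is of class $\mathcal{G}_p$ if $\phi$ is almost decreasing (there is $C>0$ with $\phi(r)\ge C\phi(s)$ whenever $r\le s$) and $\phi^p(r)r^n$ is almost increasing (there is $C>0$ with $\phi^p(r)r^n\le C\phi^p(s)s^n$ whenever $r\le s$). Generalized Morrey space: for $1\le p<\infty$ and $\phi:\mathbb{R}^+\to\mathbb{R}^+$, $L^{p,\phi}(\mathbb{R}^n)$ is the set of all $f\in L^p_{\rm loc}(\mathbb{R}^n)$ with $$\|f\|_{L^{p,\phi}}:=\sup_{B=B(a,r)}\frac{1}{\phi(r)}\left(\frac{1}{|B|}\int_B|f(x)|^p\,dx\right)^{1/p}<\infty,$$ the supremum being over all balls $B(a,r)$, $a\in\mathbb{R}^n$, $r>0$, where $|B|$ is the Lebesgue measure of $B$. Classical Morrey space: for $1\le s\le t<\infty$, $L^{s,t}(\mathbb{R}^n)$ is the set of $f\in L^s_{\rm loc}(\mathbb{R}^n)$ with $$\|f\|_{L^{s,t}}:=\sup_{B=B(a,r)}|B|^{\frac1t-\frac1s}\left(\int_B|f(x)|^s\,dx\right)^{1/s}<\infty.$$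 For $1\le u<\infty$, $u'$ denotes the dual exponent, $\frac1u+\frac1{u'}=1$ (with $\frac{1}{u'}=0$ if $u=1$). *)

(* Defs.v *)
From HB Require Import structures.
From mathcomp Require Import all_boot all_order all_algebra.
From mathcomp Require Import all_classical all_reals all_analysis.

Set Implicit Arguments.
Unset Strict Implicit.
Unset Printing Implicit Defensive.

Import Order.TTheory GRing.Theory Num.Theory.
Import numFieldNormedType.Exports.

Local Open Scope classical_set_scope.
Local Open Scope ring_scope.

(* R^n is 'rV[R]_n.  MathComp-Analysis equips it with a topology but with no
   measurable structure; as for n.-tuple R, we use the sigma-algebra generated
   by the coordinate functions, i.e. the Borel sigma-algebra of R^n. *)
Section measurable_rV.
Context {R : realType} {n : nat}.

Definition rV_coord (i : 'I_n) (x : 'rV[R]_n) : measurableTypeR R := x ord0 i.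

Let rV_set0 : g_sigma_preimage rV_coord set0.
Proof. exact: sigma_algebra0. Qed.

Let rV_setC A : g_sigma_preimage rV_coord A -> g_sigma_preimage rV_coord (~` A).
Proof. exact: sigma_algebraC. Qed.

Let rV_bigcup (F : _^nat) : (forall i, g_sigma_preimage rV_coord (F i)) ->
  g_sigma_preimage rV_coord (\bigcup_i (F i)).
Proof. exact: sigma_algebra_bigcup. Qed.

HB.instance Definition _ := @isMeasurable.Build default_measure_display
  'rV[R]_n (g_sigma_preimage rV_coord) rV_set0 rV_setC rV_bigcup.

Lemma measurable_rV_coord (i : 'I_n) : measurable_fun setT (rV_coord i).
Proof.
move=> _ Y mY; rewrite setTI; apply: sub_sigma_algebra => /=.
rewrite -bigcup_seq/=; exists i => /=; first by rewrite mem_index_enum.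
by exists Y => //; rewrite setTI.
Qed.

Lemma measurable_fun_rVP d (T : measurableType d) (f : T -> 'rV[R]_n) :
  (forall i, measurable_fun setT (rV_coord i \o f)) -> measurable_fun setT f.
Proof.
move=> mf.
have mfS : g_sigma_preimage (fun i => rV_coord i \o f) `<=` measurable.
  apply: smallest_sub; first exact: sigma_algebra_measurable.
  rewrite -bigcup_seq; apply: bigcup_sub => i _.
  by move=> A [B mB <-]; exact: mf.
move: mfS; rewrite g_sigma_preimage_comp => mfS _ A mA.
by apply: mfS; exists A.
Qed.

End measurable_rV.

Definition rV_cons {R : realType} {n : nat} (p : measurableTypeR R * 'rV[R]_n) :
  'rV[R]_n.+1 := \row_i oapp (fun j => p.2 ord0 j) p.1 (unlift ord0 i).

Definition rV_uncons {R : realType} {n : nat} (x : 'rV[R]_n.+1) :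
  measurableTypeR R * 'rV[R]_n := (x ord0 ord0, \row_j x ord0 (lift ord0 j)).

Lemma rV_cons0 {R : realType} {n : nat} (p : measurableTypeR R * 'rV[R]_n) :
  rV_cons p ord0 ord0 = p.1.
Proof. by rewrite mxE unlift_none. Qed.

Lemma rV_consS {R : realType} {n : nat} (p : measurableTypeR R * 'rV[R]_n) j :
  rV_cons p ord0 (lift ord0 j) = p.2 ord0 j.
Proof. by rewrite mxE liftK. Qed.

Lemma rV_consK {R : realType} {n : nat} :
  cancel (@rV_cons R n) (@rV_uncons R n).
Proof.
move=> [a v]; rewrite /rV_uncons rV_cons0; congr (_, _).
by apply/rowP => j; rewrite mxE rV_consS.
Qed.

Lemma measurable_rV_cons {R : realType} {n : nat} :
  measurable_fun setT (@rV_cons R n).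
Proof.
apply: measurable_fun_rVP => i; case: (unliftP ord0 i) => [j|] ->.
- rewrite (_ : _ \o _ = rV_coord j \o snd).
    apply: measurableT_comp; [exact: measurable_rV_coord|exact: measurable_snd].
  by apply/funext => p; rewrite /= /rV_coord rV_consS.
- rewrite (_ : _ \o _ = fst); first exact: measurable_fst.
  by apply/funext => p; rewrite /= /rV_coord rV_cons0.
Qed.

Lemma measurable_rV_uncons {R : realType} {n : nat} :
  measurable_fun setT (@rV_uncons R n).
Proof.
apply/measurable_fun_pairP; split; first exact: (measurable_rV_coord ord0).
apply: measurable_fun_rVP => j.
rewrite (_ : _ \o _ = rV_coord (lift ord0 j)); first exact: measurable_rV_coord.
by apply/funext => x; rewrite /= /rV_coord mxE.
Qed.

Section lebesgue_rV_step.
Context {R : realType} {n : nat}.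
Variable m : {sigma_finite_measure set 'rV[R]_n -> \bar R}.

Definition lebesgue_rV_step : set 'rV[R]_n.+1 -> \bar R :=
  pushforward ((@lebesgue_measure R) \x m)%E rV_cons.

Let mcons := @measurable_rV_cons R n.

Let step0 : lebesgue_rV_step set0 = 0%E.
Proof. by rewrite /lebesgue_rV_step /pushforward preimage_set0 measure0. Qed.

Let step_ge0 A : (0 <= lebesgue_rV_step A)%E.
Proof. exact: measure_ge0. Qed.

Let step_sigma_additive : semi_sigma_additive lebesgue_rV_step.
Proof.
move=> F mF tF mUF; rewrite /lebesgue_rV_step /pushforward preimage_bigcup.
apply: measure_semi_sigma_additive.
- by move=> k; rewrite -[X in measurable X]setTI; exact: mcons.
- apply/trivIsetP => /= i j _ _ ij; rewrite -preimage_setI.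
  by move/trivIsetP : tF => /(_ _ _ _ _ ij) ->//; rewrite preimage_set0.
- by rewrite -preimage_bigcup -[X in measurable X]setTI; exact: mcons.
Qed.

HB.instance Definition _ := isMeasure.Build _ _ _ lebesgue_rV_step
  step0 step_ge0 step_sigma_additive.

Let step_sigma_finite : sigma_finite setT lebesgue_rV_step.
Proof.
have /sigma_finiteP[F [TF ndF Foo]] := sigma_finiteT (@lebesgue_measure R).
have /sigma_finiteP[G [TG ndG Goo]] := sigma_finiteT m.
exists (fun k => rV_uncons @^-1` (F k `*` G k)).
  apply/seteqP; split => // x _; have : setT (rV_uncons x) by [].
  rewrite -setXTT TF TG => -[[i _ Fi] [j _ Gj]]; exists (maxn i j) => //; split.
    by move: Fi; exact/subsetPset/ndF/leq_maxl.
  by move: Gj; exact/subsetPset/ndG/leq_maxr.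
move=> k; have [mF Fk] := Foo k; have [mG Gk] := Goo k; split.
  rewrite -[X in measurable X]setTI; apply: measurable_rV_uncons => //.
  exact: measurableX.
rewrite /lebesgue_rV_step /pushforward -comp_preimage.
rewrite (_ : rV_uncons \o rV_cons = id) ?preimage_id.
  by rewrite product_measure1E// lte_mul_pinfty// ge0_fin_numE.
by apply/funext => p; exact: rV_consK.
Qed.

HB.instance Definition _ := Measure_isSigmaFinite.Build _ _ _ lebesgue_rV_step
  step_sigma_finite.

End lebesgue_rV_step.

(* n-dimensional Lebesgue measure, as an iterated product measure; see
   lebesgue_rV_box below. *)
Fixpoint lebesgue_rV {R : realType} (n : nat) :
    {sigma_finite_measure set 'rV[R]_n -> \bar R} :=
  match n with
  | 0 => [the {sigma_finite_measure set 'rV[R]_0 -> \bar R} of \d_(0 : 'rV[R]_0)]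
  | k.+1 => [the {sigma_finite_measure set 'rV[R]_k.+1 -> \bar R} of
              lebesgue_rV_step (lebesgue_rV k)]
  end.

Lemma lebesgue_rV_box {R : realType} (n : nat) (A : 'I_n -> set R) :
  (forall i, measurable (A i)) ->
  lebesgue_rV n [set x : 'rV[R]_n | forall i, A i (x ord0 i)] =
  (\prod_(i < n) lebesgue_measure (A i))%E.
Proof.
elim: n A => [|n IH] A mA.
  by rewrite big_ord0 /= diracE mem_set//= => -[].
have mB (k : nat) (B : 'I_k -> set R) : (forall i, measurable (B i)) ->
    measurable [set x : 'rV[R]_k | forall i, B i (x ord0 i)].
  move=> mB; rewrite (_ : mkset _ = \bigcap_(i in [set: 'I_k]) (rV_coord i @^-1` B i)).
    apply: fin_bigcap_measurable => // i _.
    rewrite -[X in measurable X]setTI.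
    by apply: measurable_rV_coord; [exact: measurableT|exact: mB].
  by apply/seteqP; split => x /= h i => [_|]; exact: h.
rewrite big_ord_recl -(IH (fun i => A (lift ord0 i)))//.
rewrite -product_measure1E; [|exact: (mA ord0)|exact: (mB _ (fun i => A (lift ord0 i)))].
rewrite /= /lebesgue_rV_step /pushforward; congr (_ _).
apply/seteqP; split => -[a v] /=.
  move=> h; split; first by have := h ord0; rewrite rV_cons0.
  by move=> i; have := h (lift ord0 i); rewrite rV_consS.
move=> [h0 h] i; case: (unliftP ord0 i) => [j|] ->; last by rewrite rV_cons0.
by rewrite rV_consS; exact: h.
Qed.

(* The Euclidean norm; the library's `|x| on 'rV[R]_n is the sup norm. *)
Definition enorm {R : realType} {n : nat} (x : 'rV[R]_n) : R :=
  Num.sqrt (\sum_(i < n) x ord0 i ^+ 2).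

Definition eball {R : realType} {n : nat} (a : 'rV[R]_n) (r : R) : set 'rV[R]_n :=
  [set x | enorm (x - a) < r].

(* 1/u' for the dual exponent u', with 1/u' = 0 when u = 1 (u' = +oo). *)
Definition inv_dual {R : realType} (u : R) : R :=
  fine ((hoelder_conjugate u%:E)^-1)%E.

Lemma inv_dualE {R : realType} (u : R) : 1 <= u -> inv_dual u = 1 - u^-1.
Proof.
move=> u1; have u0 : 0 < u by exact: lt_le_trans ltr01 u1.
have := @hoelder_conjugate_eq1 R u%:E (ltNyr u).
rewrite eqe gt_eqF// => /(_ isT); rewrite inver gt_eqF// /inv_dual.
case: (_^-1)%E => [v| |]//; rewrite -EFinD => -[<-].
by rewrite /= addrC addKr.
Qed.

Section morrey.
Context {R : realType} {n : nat}.
Implicit Types (f : 'rV[R]_n -> R) (p s t : R) (phi : R -> R).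

Local Notation mu := (@lebesgue_rV R n).

Definition Lp_loc p : set ('rV[R]_n -> R) :=
  [set f : 'rV[R]_n -> R | measurable_fun setT f /\
    forall K : set 'rV[R]_n, compact K ->
      (\int[mu]_(x in K) (`|f x| `^ p)%:E < +oo)%E].

(* The norms take values in \bar R, so that they make sense for every f. *)
Definition gmorrey_norm p phi f : \bar R :=
  ereal_sup [set (((phi r)^-1)%:E * ((mu (eball a r))^-1 *
      \int[mu]_(x in eball a r) (`|f x| `^ p)%:E) `^ p^-1)%E
    | a in [set: 'rV[R]_n] & r in `]0, +oo[].

Definition gmorrey p phi : set ('rV[R]_n -> R) :=
  [set f : 'rV[R]_n -> R | Lp_loc p f /\ (gmorrey_norm p phi f < +oo)%E].

Definition morrey_norm s t f : \bar R :=
  ereal_sup [set (mu (eball a r) `^ (t^-1 - s^-1) *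
      (\int[mu]_(x in eball a r) (`|f x| `^ s)%:E) `^ s^-1)%E
    | a in [set: 'rV[R]_n] & r in `]0, +oo[].

Definition morrey s t : set ('rV[R]_n -> R) :=
  [set f : 'rV[R]_n -> R | Lp_loc s f /\ (morrey_norm s t f < +oo)%E].

(* phi : R^+ -> R^+ is a function on R of which only the values on ]0, +oo[
   matter. *)
Definition class_G p phi : Prop :=
  [/\ forall r, 0 < r -> 0 < phi r,
      exists2 C, 0 < C & forall r s, 0 < r -> r <= s -> C * phi s <= phi r
    & exists2 C, 0 < C & forall r s, 0 < r -> r <= s ->
        phi r `^ p * r ^+ n <= C * (phi s `^ p * s ^+ n)].

(* The value at the origin, a null set, is 0. *)
Definition bessel_riesz_kernel (alpha gamma : R) (x : 'rV[R]_n) : R :=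
  enorm x `^ (alpha - n%:R) / (1 + enorm x) `^ gamma.

Definition bessel_riesz_integrand (alpha gamma : R) f (x y : 'rV[R]_n) : R :=
  bessel_riesz_kernel alpha gamma (x - y) * f y.

(* Rintegral returns a junk value when the integral diverges; the convergence
   for almost every x is bessel_riesz_defined. *)
Definition bessel_riesz (alpha gamma : R) f (x : 'rV[R]_n) : R :=
  Rintegral mu setT (bessel_riesz_integrand alpha gamma f x).

Definition bessel_riesz_defined (alpha gamma : R) f : Prop :=
  {ae mu, forall x : 'rV[R]_n,
    mu.-integrable setT (EFin \o bessel_riesz_integrand alpha gamma f x)}.

Definition bounded_operator (T : ('rV[R]_n -> R) -> 'rV[R]_n -> R)
    (X : set ('rV[R]_n -> R)) (normX : ('rV[R]_n -> R) -> \bar R)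
    (Y : set ('rV[R]_n -> R)) (normY : ('rV[R]_n -> R) -> \bar R) : Prop :=
  exists2 M : R, 0 < M &
    forall f, X f -> Y (T f) /\ (normY (T f) <= M%:E * normX f)%E.

End morrey.

Arguments class_G {R} n p phi.
Arguments bessel_riesz_kernel {R} n alpha gamma x.

(* Main.v *)
(* The ball B(a,r) is fixed and f is split at B(a,2r).  Far from a, the kernel
   satisfies K(x) <= |x|^(-n/t), so summing over the dyadic shells
   2^k r <= |y - a| < 2^(k+1) r gives the pointwise bound
   sum_k phi(2^(k+1) r) (2^k r)^(n/t') ||f||, which the integral condition
   controls by psi(r) ||f||.  Near a, a local Young inequality with exponents
   1 + 1/p2 = 1/p1 + 1/s applies, since the integral of K(x-y)^s over a ball of
   radius r, in x or in y, is O(r^(n - ns/t)).  All estimates use only that the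
   volume of a ball of radius r is comparable to r^n, never the translation
   invariance of the measure.  As K is fixed with 0 < ||K|| < +oo, the bound
   involving ||K|| follows from the boundedness of the operator. *)
Require Import Defs.
From HB Require Import structures.
From mathcomp Require Import all_boot all_order all_algebra.
From mathcomp Require Import all_classical all_reals all_analysis.
From mathcomp Require Import measurable_realfun ring lra.

Import Order.TTheory GRing.Theory Num.Theory.
Import numFieldNormedType.Exports.

Local Open Scope classical_set_scope.
Local Open Scope ring_scope.

(** * Integrals of nonnegative functions *)

(** The exponent [t] acts only through tau = n/t. Both |x|^(alpha-n) near the origin and
    |x|^(alpha-n-gamma) at infinity lie below |x|^(-tau) when tau is between n - alpha and n - alpha
    + gamma. Assumption (a) puts tau at the left end of this interval, (b) strictly inside. The
    delicate case is s = t, which only (b) allows: then |x|^(-tau s) = |x|^(-n) is integrable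
    neither near the origin nor at infinity, and the room on both sides of tau is needed to compare
    the kernel with two different powers.

    The Young bound divides by its three normalising constants, so each must be positive. Hence the
    estimates are stated for an arbitrary positive bound N of the norm of f instead of the norm,
    which may vanish, and the value of the local potential is replaced by a positive majorant. *)

Section lower_integral.
Context d (T : measurableType d) (R : realType).
Variable mu : {measure set T -> \bar R}.
Local Open Scope ereal_scope.

(* No measurability is required: the integral of a nonnegative function is a
   supremum over the simple functions below it.  This matters because phi is
   not assumed measurable in the integral condition of the theorem. *)
Lemma ge0_le_integral_lower (D1 D2 : set T) (f1 f2 : T -> \bar R) :
  D1 `<=` D2 -> (forall x, D2 x -> 0 <= f2 x) ->
  (forall x, D1 x -> 0 <= f1 x <= f2 x) ->
  \int[mu]_(x in D1) f1 x <= \int[mu]_(x in D2) f2 x.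
Proof.
move=> D12 f20 f12.
rewrite !ge0_integralE//; last by move=> x /f12/andP[].
apply: ge_ereal_sup => _ [h /= hf <-]; apply: ereal_sup_ubound => /=.
exists h => // x; apply: le_trans (hf x) _; rewrite /patch.
case: ifPn => [|_]; last by case: ifPn => // /set_mem/f20.
by rewrite inE => D1x; rewrite mem_set; [case/andP: (f12 _ D1x)|exact: D12].
Qed.

(** On [A], [g] is at most the series of its restrictions to the sets [B k], which is integrated
    term by term. Asking for a cover only where [g] is nonzero lets dyadic shells leave out their
    centre. *)
Lemma ge0_integral_cover_le (A : set T) (B : nat -> set T) (g : T -> \bar R)
    (m : nat -> R) (M : R) :
  (forall k, measurable (B k)) -> measurable_fun setT g -> (forall x, 0 <= g x) ->
  (forall x, A x -> g x != 0 -> exists k, B k x) ->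
  (forall k, \int[mu]_(x in B k) g x <= (m k)%:E) ->
  (forall K, (\sum_(k < K) m k <= M)%R) ->
  \int[mu]_(x in A) g x <= M%:E.
Proof.
move=> mB mg g0 AB Bm mM.
have gB0 k x : 0 <= (g \_ (B k)) x by exact: erestrict_ge0.
have mgB k : measurable_fun setT (g \_ (B k)).
  by apply/(measurable_restrictT _ _).1 => //; exact: measurable_funS mg.
apply: (@le_trans _ _ (\int[mu]_x \sum_(0 <= k <oo) (g \_ (B k)) x)).
  apply: ge0_le_integral_lower => // x; first by rewrite nneseries_ge0.
  move=> Ax; rewrite g0/=; have [->|gx] := eqVneq (g x) 0.
    by rewrite nneseries_ge0.
  have [k Bk] := AB _ Ax gx; apply: le_trans (nneseries_lim_ge k.+1 _) => //.
  rewrite big_nat_recr//= patchT ?inE// leeDr//.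
  by apply: sume_ge0 => i _; exact: gB0.
rewrite integral_nneseries//; apply: lime_le.
  by apply: is_cvg_nneseries => k _ _; exact: integral_ge0.
apply: nearW => K; rewrite big_mkord.
apply: le_trans (_ : \sum_(k < K) (m k)%:E <= _); last by rewrite sumEFin lee_fin.
by apply: lee_sum => k _; rewrite -integral_mkcond.
Qed.

End lower_integral.

(** * Euclidean norm and balls *)

Section euclidean.
Context {R : realType} {n : nat}.
Implicit Types (x y a : 'rV[R]_n) (r : R).
Local Notation mu := (@lebesgue_rV R n).

Lemma enorm_ge0 x : 0 <= enorm x.
Proof. exact: sqrtr_ge0. Qed.

Lemma enorm_sqr x : enorm x ^+ 2 = \sum_i x ord0 i ^+ 2.
Proof. by rewrite sqr_sqrtr// sumr_ge0// => i _; exact: sqr_ge0. Qed.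

Lemma enormN x : enorm (- x) = enorm x.
Proof. by congr Num.sqrt; apply: eq_bigr => i _; rewrite mxE sqrrN. Qed.

Lemma enormC x y : enorm (x - y) = enorm (y - x).
Proof. by rewrite -enormN opprB. Qed.

Lemma ler_coord_enorm x i : `|x ord0 i| <= enorm x.
Proof.
rewrite -sqrtr_sqr ler_wsqrtr// (bigD1 i)//= lerDl.
by rewrite sumr_ge0// => j _; exact: sqr_ge0.
Qed.

(** Cauchy-Schwarz: with X and Y the two norms and S the scalar product, the sum of the squares (x_i
    Y - y_i X)^2 equals 2XY(XY - S). Zero norms are treated apart so that XY can be cancelled. *)
Lemma ler_sum_mul_enorm x y :
  \sum_i x ord0 i * y ord0 i <= enorm x * enorm y.
Proof.
set X := enorm x; set Y := enorm y.
have [X0|X0] := eqVneq X 0.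
  rewrite X0 mul0r big1// => i _; have := ler_coord_enorm x i.
  by rewrite -/X X0 normr_le0 => /eqP->; rewrite mul0r.
have [Y0|Y0] := eqVneq Y 0.
  rewrite Y0 mulr0 big1// => i _; have := ler_coord_enorm y i.
  by rewrite -/Y Y0 normr_le0 => /eqP->; rewrite mulr0.
have XY : 0 < X * Y by rewrite mulr_gt0// lt0r ?X0 ?Y0 enorm_ge0.
have : 0 <= \sum_i (x ord0 i * Y - y ord0 i * X) ^+ 2.
  by apply: sumr_ge0 => i _; exact: sqr_ge0.
have -> : \sum_i (x ord0 i * Y - y ord0 i * X) ^+ 2 =
    Y ^+ 2 * (\sum_i x ord0 i ^+ 2) + X ^+ 2 * (\sum_i y ord0 i ^+ 2) -
    2 * (X * Y) * \sum_i x ord0 i * y ord0 i.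
  rewrite !mulr_sumr -big_split -sumrB/=.
  by apply: eq_bigr => i _; ring.
rewrite -!enorm_sqr -/X -/Y => h; rewrite -(ler_pM2l XY); nra.
Qed.

Lemma ler_enormD x y : enorm (x + y) <= enorm x + enorm y.
Proof.
rewrite -(@ler_pXn2r _ 2%N)// ?nnegrE ?addr_ge0 ?enorm_ge0//.
rewrite enorm_sqr sqrrD !enorm_sqr.
under eq_bigr do rewrite mxE sqrrD.
rewrite !big_split/= lerD2r lerD2l mulr2n lerD//; exact: ler_sum_mul_enorm.
Qed.

Lemma ler_enormB_add x y a : enorm (x - y) <= enorm (x - a) + enorm (y - a).
Proof. by rewrite (enormC y) (le_trans _ (ler_enormD _ _))// addrA subrK. Qed.

Lemma measurable_enorm : measurable_fun setT (@enorm R n).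
Proof.
apply: measurableT_comp; first exact: continuous_measurable_fun (@sqrt_continuous R).
apply: measurable_sum => i; apply: measurable_funX.
exact: (@measurable_rV_coord R n i).
Qed.

Lemma measurable_rV_sub d (T : measurableType d) (f g : T -> 'rV[R]_n) :
  measurable_fun setT f -> measurable_fun setT g ->
  measurable_fun setT (fun z => f z - g z).
Proof.
move=> mf mg; apply: measurable_fun_rVP => i.
rewrite (_ : _ \o _ = fun z => rV_coord i (f z) - rV_coord i (g z)).
  by apply: measurable_funB; apply: measurableT_comp => //; exact: measurable_rV_coord.
by apply/funext => x; rewrite /= /rV_coord !mxE.
Qed.

Lemma measurable_enorm_sub a : measurable_fun setT (fun x => enorm (x - a)).
Proof.
apply: measurableT_comp; first exact: measurable_enorm.
exact: measurable_rV_sub.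
Qed.

Lemma measurable_eball a r : measurable (eball a r).
Proof.
rewrite (_ : eball a r = setT `&` (fun x => enorm (x - a)) @^-1` `]-oo, r[%classic).
  exact: (measurable_enorm_sub a measurableT _ (measurable_itv _)).
by rewrite setTI; apply/seteqP; split => x /=; rewrite in_itv.
Qed.

Lemma subset_eball a r a' r' : enorm (a - a') + r <= r' -> eball a r `<=` eball a' r'.
Proof.
move=> h x /= xa; apply: lt_le_trans h; rewrite -(subrK a x) -addrA addrC.
by apply: le_lt_trans (ler_enormD _ _) _; rewrite addrC ltrD2l.
Qed.

Lemma measurable_rV_box (A : 'I_n -> set R) : (forall i, measurable (A i)) ->
  measurable [set x : 'rV[R]_n | forall i, A i (x ord0 i)].
Proof.
move=> mA.
rewrite (_ : mkset _ = \bigcap_(i in [set: 'I_n]) (rV_coord i @^-1` A i)).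
  apply: fin_bigcap_measurable => // i _; rewrite -[X in measurable X]setTI.
  by apply: measurable_rV_coord; [exact: measurableT|exact: mA].
by apply/seteqP; split => x /= h i => [_|]; exact: h.
Qed.

Lemma lebesgue_rV_eball_le a r : 0 <= r ->
  (mu (eball a r) <= ((2 * r) ^+ n)%:E)%E.
Proof.
move=> r0; pose A (i : 'I_n) : set R := `]a ord0 i - r, a ord0 i + r[%classic.
have <- : mu [set x | forall i, A i (x ord0 i)] = ((2 * r) ^+ n)%:E.
  rewrite lebesgue_rV_box => [|i]; last exact: measurable_itv.
  rewrite (eq_bigr (fun=> (2 * r)%:E)); last first.
    move=> i _; rewrite lebesgue_measure_itv/= lte_fin.
    case: ifPn => [_|]; first by rewrite -EFinB; congr EFin; ring.
    by rewrite -leNgt => ?; congr EFin; lra.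
  by rewrite prodEFin prodr_const card_ord.
have mA : measurable [set x : 'rV[R]_n | forall i, A i (x ord0 i)].
  by apply: measurable_rV_box => i; exact: measurable_itv.
apply: le_measure; rewrite ?inE//; first exact: measurable_eball.
move=> x /= xa i; rewrite /A/= in_itv/=.
have := le_lt_trans (ler_coord_enorm (x - a) i) xa.
by rewrite !mxE ltr_norml => /andP[? ?]; apply/andP; split; lra.
Qed.

(** The ball contains the cube of half-side r/(n+1), because n/(n+1)^2 < 1. Taking n+1 keeps this
    inequality strict and the quotient defined in every dimension, 0 included. *)
Lemma lebesgue_rV_eball_ge a r : 0 < r ->
  (((2 / n.+1%:R * r) ^+ n)%:E <= mu (eball a r))%E.
Proof.
move=> r0; pose e := r / n.+1%:R.
have e0 : 0 < e by rewrite divr_gt0.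
pose A (i : 'I_n) : set R := `]a ord0 i - e, a ord0 i + e[%classic.
have <- : mu [set x | forall i, A i (x ord0 i)] = ((2 / n.+1%:R * r) ^+ n)%:E.
  rewrite lebesgue_rV_box => [|i]; last exact: measurable_itv.
  rewrite (eq_bigr (fun=> (2 / n.+1%:R * r)%:E)); last first.
    move=> i _; rewrite lebesgue_measure_itv/= lte_fin ifT; last by lra.
    by rewrite -EFinB; congr EFin; rewrite /e; ring.
  by rewrite prodEFin prodr_const card_ord.
have mA : measurable [set x : 'rV[R]_n | forall i, A i (x ord0 i)].
  by apply: measurable_rV_box => i; exact: measurable_itv.
apply: le_measure; rewrite ?inE//; first exact: measurable_eball.
move=> x /= xa; rewrite /eball/= -(@ltr_pXn2r _ 2%N)// ?nnegrE ?enorm_ge0 ?ltW//.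
rewrite enorm_sqr; apply: (@le_lt_trans _ _ (\sum_(i < n) e ^+ 2)).
  apply: ler_sum => i _; rewrite -real_normK ?num_real// lerXn2r ?nnegrE//
    ?normr_ge0 ?(ltW e0)//.
  by have := xa i; rewrite /A/= in_itv/= !mxE ler_norml => /andP[? ?]; apply/andP; split; lra.
rewrite sumr_const card_ord -[X in X < _]mulr_natl /e expr_div_n mulrCA gtr_pMr ?exprn_gt0//.
rewrite ltr_pdivrMr ?exprn_gt0// mul1r -natrX ltr_nat.
by rewrite -mulnn (leq_trans (ltnSn n))// leq_pmulr.
Qed.

End euclidean.

(** * Integrals of powers of the norm *)

Section dyadic.
Context {R : realType}.

Lemma sum_geometric_le (q : R) K : 0 <= q < 1 -> \sum_(k < K) q ^+ k <= (1 - q)^-1.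
Proof.
move=> /andP[q0 q1]; rewrite -[leRHS]mul1r ler_pdivlMr ?subr_gt0//.
rewrite mulrC -[1 - q]opprB mulNr -subrX1 opprB gerBl exprn_ge0//.
Qed.

Lemma dyadic_bracket (z : R) : 1 <= z -> exists k, 2 ^+ k <= z < 2 ^+ k.+1.
Proof.
move=> z1; have ex : exists k, z < 2 ^+ k.
  exists (Num.truncn z).+1; apply: lt_le_trans (truncnS_gt z) _.
  by rewrite -natrX ler_nat ltnW// ltn_expl.
have := ex_minnP ex; case=> -[|k]; first by rewrite expr0 ltNge z1.
move=> zk kmin; exists k; rewrite zk andbT leNgt; apply/negP => /kmin.
by rewrite ltnn.
Qed.

Lemma gt1_powR_lt1 (a b : R) : 1 < a -> b < 0 -> a `^ b < 1.
Proof.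
move=> a1 b0; rewrite /powR gt_eqF ?(lt_trans ltr01)// expR_lt1.
by rewrite nmulr_rlt0// ln_gt0.
Qed.

End dyadic.

Section power_integrals.
Context {R : realType} {n : nat}.
Implicit Types (x y a : 'rV[R]_n) (r b : R).
Local Notation mu := (@lebesgue_rV R n).

Lemma integral_sub_eball_le (B : set 'rV[R]_n) (g : 'rV[R]_n -> \bar R) a r (v : R) :
  0 <= r -> 0 <= v -> B `<=` eball a r -> (forall x, B x -> (0 <= g x <= v%:E)%E) ->
  (\int[mu]_(x in B) g x <= (v * (2 * r) ^+ n)%:E)%E.
Proof.
move=> r0 v0 Ba gv.
apply: (@le_trans _ _ (\int[mu]_(x in eball a r) cst v%:E x)%E).
  by apply: ge0_le_integral_lower => // x _; rewrite lee_fin.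
rewrite integral_cst; last exact: measurable_eball.
by rewrite EFinM lee_wpmul2l ?lee_fin ?lebesgue_rV_eball_le.
Qed.

Lemma measurable_enorm_sub_powR y b :
  measurable_fun setT (fun x => (enorm (x - y) `^ b)%:E).
Proof.
apply: (measurable_EFinP _ _).2; apply: (measurableT_comp (measurable_powR b)).
exact: measurable_enorm_sub.
Qed.

(** Serves both ends of the scale: [w] = 1/2 with b < n near [y], and [w] = 2 with b > n at
    infinity; in each case the shells contribute a convergent geometric series. They overlap, having
    ratio of radii 4, so that brackets closed on either side fit in. *)
Lemma integral_powR_shells_le (E : set 'rV[R]_n) y (w r b : R) :
  0 < w -> 0 < r -> 0 < b -> w `^ (n%:R - b) < 1 ->
  (forall x, E x -> 0 < enorm (x - y) ->
    exists k, r * w ^+ k / 2 <= enorm (x - y) < 2 * (r * w ^+ k)) ->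
  (\int[mu]_(x in E) (enorm (x - y) `^ (- b))%:E <=
   (2 `^ b * 4 ^+ n / (1 - w `^ (n%:R - b)) * r `^ (n%:R - b))%:E)%E.
Proof.
move=> w0 r0 b0 w1 Eshell; set q := w `^ _ in w1 *.
have rw0 k : 0 < r * w ^+ k by rewrite mulr_gt0 ?exprn_gt0.
pose B k := eball y (2 * (r * w ^+ k)) `\` eball y (r * w ^+ k / 2).
(* The power at the inner radius times the volume of a cube around the outer ball. *)
pose m k := (r * w ^+ k / 2) `^ (- b) * (2 * (2 * (r * w ^+ k))) ^+ n.
have mE k : m k = 2 `^ b * 4 ^+ n * r `^ (n%:R - b) * q ^+ k.
  have rwn : (r * w ^+ k) `^ (n%:R - b) = r `^ (n%:R - b) * q ^+ k.
    rewrite powRM ?exprn_ge0 ?ltW//; congr *%R.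
    by rewrite -[RHS]powR_mulrn ?powR_ge0// [RHS]powRAC powR_mulrn// ltW.
  rewrite -mulrA -rwn powRD; last by rewrite (gt_eqF (rw0 k)) implybT.
  rewrite powR_mulrn; last by rewrite ltW.
  rewrite /m powRM ?invr_ge0// ?ltW// -powR_inv1// -powRrM mulN1r opprK.
  have -> : 2 * (2 * (r * w ^+ k)) = 4 * (r * w ^+ k) by ring.
  by rewrite exprMn; ring.
apply: (@ge0_integral_cover_le _ _ _ mu E B _ m).
- by move=> k; apply: measurableD; exact: measurable_eball.
- exact: measurable_enorm_sub_powR.
- by move=> x; rewrite lee_fin powR_ge0.
- move=> x Ex xy; have [|k /andP[k1 k2]] := Eshell x Ex.
    (* At the centre the power of 0 is 0 by convention, so the point is not among those to cover. *)
    rewrite lt_neqAle enorm_ge0 andbT eq_sym; apply: contra xy => /eqP ->.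
    by rewrite powR0// oppr_eq0 gt_eqF.
  by exists k; split => //=; apply/negP; rewrite -leNgt.
- move=> k; apply: (@integral_sub_eball_le _ _ y).
  + by rewrite mulr_ge0// ltW.
  + exact: powR_ge0.
  + by move=> x [].
  + move=> x [_ /negP]; rewrite -leNgt => xk; rewrite !lee_fin powR_ge0/=.
    rewrite !powRN lef_pV2 ?posrE; last 2 first.
    * by rewrite powR_gt0// (lt_le_trans _ xk)// divr_gt0.
    * by rewrite powR_gt0// divr_gt0.
    * by rewrite ge0_ler_powR ?nnegrE ?enorm_ge0 ?divr_ge0 ?(ltW b0) ?(ltW (rw0 k)).
- move=> K; under eq_bigr do rewrite mE; rewrite -mulr_sumr [leRHS]mulrAC.
  rewrite ler_wpM2l//; last by apply: sum_geometric_le; rewrite powR_ge0 w1.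
  by rewrite !mulr_ge0 ?powR_ge0 ?exprn_ge0.
Qed.

Lemma integral_eball_powR_le b : 0 < b < n%:R ->
  exists2 A, 0 < A & forall y r, 0 < r ->
    (\int[mu]_(x in eball y r) (enorm (x - y) `^ (- b))%:E <=
     (A * r `^ (n%:R - b))%:E)%E.
Proof.
move=> /andP[b0 bn].
have q1 : 2^-1 `^ (n%:R - b) < 1 :> R.
  rewrite -powR_inv1// -powRrM mulN1r opprB.
  by rewrite gt1_powR_lt1 ?ltr1n// subr_lt0.
exists (2 `^ b * 4 ^+ n / (1 - 2^-1 `^ (n%:R - b))).
  by rewrite divr_gt0 ?subr_gt0// mulr_gt0 ?powR_gt0 ?exprn_gt0.
move=> y r r0; apply: integral_powR_shells_le => // x xy xy0.
have [|k /andP[k1 k2]] := dyadic_bracket (r / enorm (x - y)).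
  by rewrite ler_pdivlMr// mul1r ltW.
exists k; rewrite exprVn; apply/andP; split.
- rewrite -mulrA -invfM -exprSr ler_pdivrMr ?exprn_gt0// mulrC.
  by rewrite -ler_pdivrMr// ltW.
- apply: (@le_lt_trans _ _ (r / 2 ^+ k)); last by rewrite ltr_pMl ?ltr1n// divr_gt0 ?exprn_gt0.
  by rewrite ler_pdivlMr ?exprn_gt0// mulrC -ler_pdivlMr.
Qed.

Lemma integral_eballC_powR_le b : n%:R < b ->
  exists2 A, 0 < A & forall y,
    (\int[mu]_(x in ~` eball y 1) (enorm (x - y) `^ (- b))%:E <= A%:E)%E.
Proof.
move=> nb; have b0 : 0 < b by apply: le_lt_trans nb.
have q1 : 2 `^ (n%:R - b) < 1 :> R.
  by rewrite gt1_powR_lt1 ?ltr1n// subr_lt0.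
exists (2 `^ b * 4 ^+ n / (1 - 2 `^ (n%:R - b))).
  by rewrite divr_gt0 ?subr_gt0// mulr_gt0 ?powR_gt0 ?exprn_gt0.
move=> y; have := @integral_powR_shells_le (~` eball y 1) y 2 1 b.
rewrite powR1 mulr1; apply => // x /negP; rewrite -leNgt => xy _.
have [k /andP[k1 k2]] := dyadic_bracket _ xy.
exists k; rewrite mul1r -exprS k2 andbT (le_trans _ k1)//.
by rewrite ler_pdivrMr// ler_peMr ?exprn_ge0 ?ler1n.
Qed.

End power_integrals.

(** * The Bessel-Riesz kernel *)

Section kernel.
Context {R : realType} {n : nat}.
Variables (alpha gamma : R).
Hypotheses (halpha : 0 < alpha < n%:R) (hgamma : 0 <= gamma).
Implicit Types (x y a : 'rV[R]_n) (r s tau : R).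
Local Notation mu := (@lebesgue_rV R n).
Local Notation K := (bessel_riesz_kernel n alpha gamma).

Lemma bessel_riesz_kernel_ge0 x : 0 <= K x.
Proof. by rewrite divr_ge0// powR_ge0. Qed.

Lemma bessel_riesz_kernelC x y : K (x - y) = K (y - x).
Proof. by rewrite /bessel_riesz_kernel enormC. Qed.

Lemma measurable_bessel_riesz_kernel : measurable_fun setT K.
Proof.
have mpow (f : 'rV[R]_n -> R) b : measurable_fun setT f ->
    measurable_fun setT (fun x => f x `^ b).
  by move=> mf; exact: (measurableT_comp (measurable_powR b)).
rewrite (_ : K = fun x => enorm x `^ (alpha - n%:R) * (1 + enorm x) `^ (- gamma)).
  apply: measurable_funM; apply: mpow; first exact: measurable_enorm.
  by apply: measurable_funD => //; exact: measurable_enorm.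
by apply/funext => x; rewrite powRN.
Qed.

(** For |x| <= 1 the denominator is at least 1 and the lower bound on [tau] decides; for |x| >= 1
    the denominator is at least |x|^gamma and the upper bound decides. At the origin both sides are
    0 by the convention on powers of 0. *)
Lemma bessel_riesz_kernel_le_powR tau x :
  n%:R - alpha <= tau <= n%:R - alpha + gamma -> K x <= enorm x `^ (- tau).
Proof.
move: halpha => /andP[a0 an] /andP[tau1 tau2]; rewrite /bessel_riesz_kernel.
have := enorm_ge0 x; rewrite le_eqVlt => /predU1P[<-|x0].
  by rewrite !powR0 ?mul0r// lt_eqF//; lra.
have x1 : 0 < 1 + enorm x by rewrite ltr_wpDl.
rewrite ler_pdivrMr ?powR_gt0//; have [xle1|/ltW xge1] := leP (enorm x) 1.
  apply: (@le_trans _ _ (enorm x `^ (- tau))).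
    by rewrite ger_powR ?x0//; lra.
  rewrite ler_peMr ?powR_ge0// -[leLHS](powRr0 (1 + enorm x)) ler_powR//.
  by rewrite lerDl ltW.
apply: (@le_trans _ _ (enorm x `^ (- tau) * enorm x `^ gamma)).
  rewrite -powRD; last by rewrite (gt_eqF x0) implybT.
  by rewrite ler_powR//; lra.
by rewrite ler_wpM2l ?powR_ge0// ge0_ler_powR ?nnegrE ?lerDr ?(ltW x0) ?(ltW x1).
Qed.

Lemma bessel_riesz_kernel_powR_le tau s x : 0 <= s ->
  n%:R - alpha <= tau <= n%:R - alpha + gamma ->
  K x `^ s <= enorm x `^ (- (tau * s)).
Proof.
move=> s0 htau; rewrite -mulNr powRrM ge0_ler_powR ?nnegrE ?powR_ge0//.
- exact: bessel_riesz_kernel_ge0.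
- exact: bessel_riesz_kernel_le_powR.
Qed.

Lemma measurable_bessel_riesz_kernel_powR s y :
  measurable_fun setT (fun x => (K (x - y) `^ s)%:E).
Proof.
apply: (measurable_EFinP _ _).2; apply: (measurableT_comp (measurable_powR s)).
apply: measurableT_comp; first exact: measurable_bessel_riesz_kernel.
exact: measurable_rV_sub.
Qed.

Section powers.
Variables (tau s : R).
Hypotheses (s0 : 0 < s) (htau : n%:R - alpha <= tau <= n%:R - alpha + gamma).
Hypothesis hs : tau * s < n%:R \/
  tau * s = n%:R /\ n%:R - alpha < tau < n%:R - alpha + gamma.

(** If [tau * s] < n, comparison with the single power |x|^(-tau s) suffices. If [tau * s] = n, the
    exponent n - alpha is used inside the unit ball and n - alpha + gamma outside: multiplied by
    [s], they fall strictly below and strictly above n. *)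
Lemma integral_eball_kernel_le : exists2 A, 0 < A & forall y r, 0 < r ->
  (\int[mu]_(x in eball y r) (K (x - y) `^ s)%:E <=
   (A * r `^ (n%:R - tau * s))%:E)%E.
Proof.
have tau0 : 0 < tau by move: halpha htau => /andP[? ?] /andP[? _]; lra.
have le_pow (D : set 'rV[R]_n) y tau' :
    n%:R - alpha <= tau' <= n%:R - alpha + gamma ->
    (\int[mu]_(x in D) (K (x - y) `^ s)%:E <=
     \int[mu]_(x in D) (enorm (x - y) `^ (- (tau' * s)))%:E)%E.
  move=> htau'; apply: ge0_le_integral_lower => // x _; rewrite !lee_fin.
    exact: powR_ge0.
  by rewrite powR_ge0 bessel_riesz_kernel_powR_le// ltW.
case: hs => [tausn|[tausn /andP[htau1 htau2]]].
  have [|A A0 hA] := @integral_eball_powR_le R n (tau * s).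
    by rewrite tausn mulr_gt0.
  exists A; first exact: A0.
  move=> y r r0; apply: (le_trans _ (hA y r r0)).
  exact: (le_pow (eball y r) y tau htau).
have [|A A0 hA] := @integral_eball_powR_le R n ((n%:R - alpha) * s).
  move: halpha => /andP[? ?]; apply/andP; split; first by rewrite mulr_gt0// subr_gt0.
  by rewrite -[ltRHS]tausn ltr_pM2r.
have [|A' A'0 hA'] := @integral_eballC_powR_le R n ((n%:R - alpha + gamma) * s).
  by rewrite -[ltLHS]tausn ltr_pM2r.
exists (A + A'); first exact: addr_gt0.
(* The claimed power of [r] is now 1, so the integral over the whole space must be bounded by a
   constant. *)
move=> y r r0; rewrite tausn subrr powRr0 mulr1.
apply: (@le_trans _ _ (\int[mu]_(x in eball y 1 `|` ~` eball y 1) (K (x - y) `^ s)%:E)%E).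
  by apply: ge0_le_integral_lower => [x _|x _|x _]; rewrite ?setUv// lee_fin powR_ge0 ?lexx.
rewrite ge0_integral_setU//=; first last.
- by apply/disj_setPS => x [].
- by move=> x _; rewrite lee_fin powR_ge0.
- by rewrite setUv; exact: measurable_bessel_riesz_kernel_powR.
- by apply: measurableC; exact: measurable_eball.
- exact: measurable_eball.
rewrite EFinD leeD//.
  apply: le_trans (le_pow _ _ (n%:R - alpha) _) _; first by lra.
  by have := hA y 1 ltr01; rewrite powR1 mulr1.
by apply: le_trans (le_pow _ _ (n%:R - alpha + gamma) _) (hA' y); lra.
Qed.

(** The Morrey norm of the kernel involves balls that are not centred at the singularity. If |a| <=
    2r, the ball lies in B(0,3r); otherwise |x| >= r on it and the kernel is at most r^(-tau). *)
Lemma integral_eball_kernel0_le : exists2 A, 0 < A & forall a r, 0 < r ->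
  (\int[mu]_(x in eball a r) (K x `^ s)%:E <=
   (A * r `^ (n%:R - tau * s))%:E)%E.
Proof.
have tau0 : 0 < tau by move: halpha htau => /andP[? ?] /andP[? _]; lra.
have [A A0 hA] := integral_eball_kernel_le.
exists (A * 3 `^ (n%:R - tau * s) + 2 ^+ n).
  by rewrite addr_gt0 ?mulr_gt0 ?powR_gt0 ?exprn_gt0.
move=> a r r0; rewrite mulrDl; have [a2r|/ltW a2r] := leP (enorm a) (2 * r).
  apply: (@le_trans _ _ (\int[mu]_(x in eball 0 (3 * r)) (K (x - 0) `^ s)%:E)%E).
    apply: ge0_le_integral_lower => [|x _|x _]; rewrite ?lee_fin ?powR_ge0 ?subr0 ?lexx//.
    by apply: subset_eball; rewrite subr0; lra.
  apply: le_trans (hA _ _ _) _; first by rewrite mulr_gt0.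
  by rewrite lee_fin powRM ?(ltW r0)// mulrA lerDl mulr_ge0 ?powR_ge0.
apply: (@le_trans _ _ (r `^ (- (tau * s)) * (2 * r) ^+ n)%:E).
  apply: integral_sub_eball_le; [exact: ltW|exact: powR_ge0|exact: subset_refl|].
  move=> x xa; rewrite !lee_fin powR_ge0/=.
  apply: le_trans (bessel_riesz_kernel_powR_le _ _ _ _ htau) _; first exact: ltW.
  have rx : r <= enorm x.
    have := ler_enormD (a - x) x; rewrite subrK enormC.
    by move: xa; rewrite /eball/=; lra.
  rewrite !powRN lef_pV2 ?posrE ?powR_gt0//; last exact: lt_le_trans rx.
  by rewrite ge0_ler_powR ?nnegrE ?enorm_ge0 ?(ltW r0) ?mulr_ge0 ?(ltW tau0) ?(ltW s0).
rewrite lee_fin exprMn -[r ^+ n]powR_mulrn ?(ltW r0)// mulrCA -powRD; last first.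
  by rewrite (gt_eqF r0) implybT.
by rewrite [- _ + _]addrC lerDr !mulr_ge0 ?powR_ge0// ltW.
Qed.

End powers.
End kernel.

(** * The integral condition on phi *)

Section dyadic_sum.
Context {R : realType}.
Variables (phi : R -> R) (beta C C0 : R).
Hypotheses (beta0 : 0 <= beta) (C_gt0 : 0 < C).
Hypothesis phi_gt0 : forall r, 0 < r -> 0 < phi r.
Hypothesis phi_almost_decr : forall r s, 0 < r -> r <= s -> C * phi s <= phi r.
Local Notation mu := (@lebesgue_measure R).

(** A step function on the intervals ]2^k r, 2^(k+1) r] lies below the integrand. Since beta - 1 may
    have either sign, x^beta is bounded at the left end and 1/x at the right end; length over right
    end gives the factor 1/2, and almost decrease gives [C]. *)
Lemma sum_dyadic_le_integral (r : R) K : 0 < r ->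
  ((\sum_(k < K) C / 2 * (phi (2 ^+ k.+1 * r) * (2 ^+ k * r) `^ beta))%:E <=
   \int[mu]_(x in `]r, +oo[) (phi x * x `^ (beta - 1))%:E)%E.
Proof.
move=> r0; have r2 k : 0 < 2 ^+ k * r by rewrite mulr_gt0 ?exprn_gt0.
pose I k : set R := `]2 ^+ k * r, 2 ^+ k.+1 * r]%classic.
have mI k : measurable (I k) by exact: measurable_itv.
have muI k : mu (I k) = (2 ^+ k * r)%:E.
  rewrite lebesgue_measure_itv/= lte_fin exprS -mulrA.
  by have r2k := r2 k; rewrite ifT -?EFinB; [congr EFin; ring|lra].
pose c k := C * phi (2 ^+ k.+1 * r) * ((2 ^+ k * r) `^ beta / (2 ^+ k.+1 * r)).
have c0 k : 0 <= c k.
  by rewrite !mulr_ge0 ?powR_ge0 ?invr_ge0 ?exprn_ge0// ltW ?phi_gt0.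
pose h (k : nat) (x : R) : \bar R := ((c k)%:E * (\1_(I k) x)%:E)%E.
have mh k : measurable_fun setT (h k).
  by apply: (measurable_EFinP _ (fun x => c k * \1_(I k) x)).2;
    apply: measurable_funM => //; exact: measurable_indic.
have h0 k x : (0 <= h k x)%E by rewrite mule_ge0 ?lee_fin.
rewrite -sumEFin; apply: (@le_trans _ _ (\int[mu]_x \sum_(k < K) h k x)%E).
  rewrite ge0_integral_sum//; last by move=> k; exact: mh.
  apply: lee_sum => k _.
  rewrite ge0_integralZl_EFin//; last first.
    by apply: (measurable_EFinP _ \1_(I k)).2; exact: measurable_indic.
  rewrite integral_indic ?setIT//.
  rewrite [X in (_ <= _ * X)%E](muI k) -EFinM lee_fin /c exprS -!mulrA.
  rewrite le_eqVlt; apply/orP; left; apply/eqP.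
  by field; rewrite (gt_eqF r0) expf_neq0.
  exact: mI.
rewrite [leRHS]integral_mkcond; apply: ge0_le_integral_lower => // x _.
  by apply: erestrict_ge0 => y; rewrite /= in_itv/= andbT => ry;
    rewrite lee_fin mulr_ge0 ?powR_ge0// ltW// phi_gt0// (lt_trans r0).
rewrite sume_ge0//=.
have [[j [jK Ij]]|nI] := pselect (exists j, (j < K)%N /\ I j x); last first.
  rewrite big1; last first.
    move=> k _; rewrite /h indicE memNset ?mule0// => Ik.
    by apply: nI; exists k.
  by apply: erestrict_ge0 => y; rewrite /= in_itv/= andbT => ry;
    rewrite lee_fin mulr_ge0 ?powR_ge0// ltW// phi_gt0// (lt_trans r0).
move: (Ij); rewrite /I/= in_itv/= => /andP[jx xj].
have x0 : 0 < x by exact: lt_trans jx.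
rewrite (bigD1 (Ordinal jK))//= big1; last first.
  move=> k kj; rewrite /h indicE memNset ?mule0// /I/= in_itv/= => /andP[kx xk].
  have {kj} : (k < j)%N || (j < k)%N by rewrite -neq_ltn.
  case/orP => lt; have := ler_weXn2l (ler1n R 2) lt; rewrite -(ler_pM2r r0);
    by move: kx xk jx xj; lra.
rewrite adde0 /h indicE mem_set// mule1 patchT; last first.
  by rewrite inE/= in_itv/= andbT (le_lt_trans _ jx)// ler_peMl ?exprn_ege1 ?ler1n// ltW.
rewrite lee_fin ler_pM//.
- by rewrite mulr_ge0 ?ltW ?phi_gt0.
- by rewrite mulr_ge0 ?powR_ge0 ?invr_ge0 ?ltW.
- exact: phi_almost_decr.
- rewrite powRD; last by rewrite (gt_eqF x0) implybT.
  rewrite powR_inv1 ?(ltW x0)// ler_pM ?powR_ge0 ?invr_ge0 ?(ltW (r2 _))//.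
    by rewrite ge0_ler_powR ?nnegrE ?(ltW x0) ?(ltW (r2 _)) ?(ltW jx).
  by rewrite lef_pV2 ?posrE.
Qed.

Lemma sum_dyadic_le (r : R) K : 0 < r ->
  (\int[mu]_(x in `]r, +oo[) (phi x * x `^ (beta - 1))%:E <=
    (C0 * phi r * r `^ beta)%:E)%E ->
  \sum_(k < K) phi (2 ^+ k.+1 * r) * (2 ^+ k * r) `^ beta <=
  2 / C * C0 * (phi r * r `^ beta).
Proof.
move=> r0 /(le_trans (sum_dyadic_le_integral _ K r0)).
rewrite lee_fin -mulr_sumr => h; rewrite -(@ler_pM2l _ (C / 2)) ?divr_gt0//.
by apply: le_trans h _; rewrite le_eqVlt; apply/orP; left; apply/eqP; field; rewrite gt_eqF.
Qed.

End dyadic_sum.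

(** * A Young inequality *)

Section young.
Context {R : realType}.
Implicit Types (p q s : R).

Lemma powR_inv_le p (x y : R) : 0 < p -> 0 <= x -> 0 <= y ->
  (x `^ p^-1 <= y) = (x <= y `^ p).
Proof.
move=> p0 x0 y0; have pp : p^-1 * p = 1 by rewrite mulVf ?gt_eqF.
apply/idP/idP => h.
  rewrite -[leLHS](powRr1 x0) -pp powRrM.
  by rewrite ge0_ler_powR ?nnegrE ?powR_ge0// ltW.
rewrite -[leRHS](powRr1 y0) -pp mulrC powRrM.
by rewrite ge0_ler_powR ?nnegrE ?powR_ge0 ?invr_ge0// ltW.
Qed.

(* Writing k f = (k^s f^p)^(1/q) (k^s)^(1-1/p) (f^p)^(1-1/s), whose exponents
   sum to 1, and bounding the product by the largest of the three normalised
   factors avoids any appeal to Hoelder's inequality. *)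
Lemma young_pointwise p q s (k f d A F : R) :
  1 <= p -> 1 <= s -> 0 < q -> q^-1 = p^-1 + s^-1 - 1 ->
  0 <= k -> 0 <= f -> 0 < d -> 0 < A -> 0 < F ->
  k * f <= d `^ q^-1 * A `^ (1 - p^-1) * F `^ (1 - s^-1) *
    (d^-1 * (k `^ s * f `^ p) + A^-1 * k `^ s + F^-1 * f `^ p).
Proof.
move=> p1 s1 q0 qE k0 f0 d0 A0 F0.
have p0 : 0 < p by exact: lt_le_trans p1.
have s0 : 0 < s by exact: lt_le_trans s1.
have p'0 : 0 <= 1 - p^-1 by rewrite subr_ge0 invf_le1.
have s'0 : 0 <= 1 - s^-1 by rewrite subr_ge0 invf_le1.
set X := d^-1 * _; set Y := A^-1 * _; set Z := F^-1 * _.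
have [X0 Y0 Z0] : [/\ 0 <= X, 0 <= Y & 0 <= Z].
  by split; rewrite !mulr_ge0 ?powR_ge0 ?invr_ge0// ltW.
have [k00|kn0] := eqVneq k 0.
  by rewrite [in leLHS]k00 mul0r !mulr_ge0 ?powR_ge0 ?addr_ge0.
have [f00|fn0] := eqVneq f 0.
  by rewrite [in leLHS]f00 mulr0 !mulr_ge0 ?powR_ge0 ?addr_ge0.
have kE : k `^ (s * q^-1) * k `^ (s * (1 - p^-1)) = k.
  rewrite -powRD ?kn0 ?implybT// -mulrDr qE -[RHS](powRr1 k0); congr powR.
  by field; rewrite !gt_eqF.
have fE : f `^ (p * q^-1) * f `^ (p * (1 - s^-1)) = f.
  rewrite -powRD ?fn0 ?implybT// -mulrDr qE -[RHS](powRr1 f0); congr powR.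
  by field; rewrite !gt_eqF.
have -> : k * f = d `^ q^-1 * A `^ (1 - p^-1) * F `^ (1 - s^-1) *
    (X `^ q^-1 * Y `^ (1 - p^-1) * Z `^ (1 - s^-1)).
  transitivity ((d * X) `^ q^-1 * (A * Y) `^ (1 - p^-1) * (F * Z) `^ (1 - s^-1)).
    rewrite !mulVKf ?gt_eqF// powRM ?powR_ge0// -!powRrM.
    by rewrite -{1}kE -{1}fE; ring.
  rewrite (powRM _ (ltW d0) X0) (powRM _ (ltW A0) Y0) (powRM _ (ltW F0) Z0).
  by rewrite [RHS]mulrACA; congr *%R; rewrite [RHS]mulrACA.
rewrite ler_wpM2l ?mulr_ge0 ?powR_ge0//.
set W := X + Y + Z; have W0 : 0 <= W by rewrite !addr_ge0.
have -> : W = W `^ q^-1 * W `^ (1 - p^-1) * W `^ (1 - s^-1).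
  have [->|Wn0] := eqVneq W 0; first by rewrite powR0 ?mul0r// invr_neq0 ?gt_eqF.
  rewrite -!powRD ?Wn0 ?implybT// qE -[LHS](powRr1 W0); congr powR; ring.
rewrite !ler_pM ?mulr_ge0 ?powR_ge0//; apply: ge0_ler_powR;
  rewrite ?nnegrE ?invr_ge0 ?(ltW q0)// /W; lra.
Qed.

(** The factor 3 counts the normalised terms of [young_pointwise], each of integral at most 1. *)
Lemma young_integral_le d (T : measurableType d) (mu : {measure set T -> \bar R})
    (E : set T) (k f : T -> R) p q s (D A F : R) :
  1 <= p -> 1 <= s -> 0 < q -> q^-1 = p^-1 + s^-1 - 1 ->
  measurable E -> measurable_fun setT k -> measurable_fun setT f ->
  (forall y, 0 <= k y) -> (forall y, 0 <= f y) -> 0 < D -> 0 < A -> 0 < F ->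
  (\int[mu]_(y in E) (k y `^ s * f y `^ p)%:E <= D%:E)%E ->
  (\int[mu]_(y in E) (k y `^ s)%:E <= A%:E)%E ->
  (\int[mu]_(y in E) (f y `^ p)%:E <= F%:E)%E ->
  (\int[mu]_(y in E) (k y * f y)%:E <=
   (3 * (D `^ q^-1 * A `^ (1 - p^-1) * F `^ (1 - s^-1)))%:E)%E.
Proof.
move=> p1 s1 q0 qE mE mk mf k0 f0 D0 A0 F0 hD hA hF.
set c := D `^ _ * _ * _; have c0 : 0 <= c by rewrite !mulr_ge0 ?powR_ge0.
pose u y : \bar R := (k y `^ s * f y `^ p)%:E.
pose v y : \bar R := (k y `^ s)%:E.
pose w y : \bar R := (f y `^ p)%:E.
have mks : measurable_fun setT (fun y => k y `^ s).
  exact: (measurableT_comp (measurable_powR s)).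
have mfp : measurable_fun setT (fun y => f y `^ p).
  exact: (measurableT_comp (measurable_powR p)).
have mu' : measurable_fun E u.
  apply: measurable_funTS; apply: (measurable_EFinP _ _).2.
  exact: measurable_funM.
have mv : measurable_fun E v by apply: measurable_funTS; exact: (measurable_EFinP _ _).2.
have mw : measurable_fun E w by apply: measurable_funTS; exact: (measurable_EFinP _ _).2.
have u0 y : (0 <= u y)%E by rewrite lee_fin mulr_ge0 ?powR_ge0.
have v0 y : (0 <= v y)%E by rewrite lee_fin powR_ge0.
have w0 y : (0 <= w y)%E by rewrite lee_fin powR_ge0.
have scaled_le1 (g : T -> \bar R) (z : R) : 0 < z -> measurable_fun E g ->
    (forall y, 0 <= g y)%E -> (\int[mu]_(y in E) g y <= z%:E)%E ->
    (\int[mu]_(y in E) (z^-1%:E * g y) <= 1)%E.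
  move=> z0 mg g0 gz; rewrite ge0_integralZl_EFin ?invr_ge0 ?(ltW z0)//.
  apply: (@le_trans _ _ (z^-1%:E * z%:E)%E).
    by rewrite lee_wpmul2l ?lee_fin ?invr_ge0 ?(ltW z0).
  by rewrite -EFinM mulVf ?gt_eqF.
have mscaled (g : T -> \bar R) (z : R) : measurable_fun E g ->
    measurable_fun E (fun y => z%:E * g y)%E.
  by move=> mg; exact: emeasurable_funM.
have scaled0 (g : T -> \bar R) (z : R) y : 0 < z -> (0 <= g y)%E -> (0 <= z^-1%:E * g y)%E.
  by move=> z0 g0; rewrite mule_ge0// lee_fin invr_ge0 ltW.
apply: (@le_trans _ _ (\int[mu]_(y in E) (c%:E *
    ((D^-1%:E * u y + A^-1%:E * v y) + F^-1%:E * w y)))%E).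
  apply: ge0_le_integral_lower => // y _.
    apply: mule_ge0 => //.
    by apply: adde_ge0; [apply: adde_ge0|]; exact: scaled0.
  by rewrite /u /v /w -!EFinM !lee_fin mulr_ge0//= young_pointwise.
have s0 (g : T -> \bar R) (z : R) : 0 < z -> (forall y, 0 <= g y)%E ->
    (forall y, E y -> 0 <= z^-1%:E * g y)%E by move=> z0 g0 z1 _; exact: scaled0.
have ms2 : measurable_fun E (fun y => D^-1%:E * u y + A^-1%:E * v y)%E.
  by apply: emeasurable_funD; exact: mscaled.
have s20 y : E y -> (0 <= D^-1%:E * u y + A^-1%:E * v y)%E.
  by move=> Ey; rewrite adde_ge0// s0.
rewrite ge0_integralZl_EFin//; last 2 first.
- by move=> y Ey; rewrite adde_ge0 ?s20 ?s0.
- by apply: emeasurable_funD => //; exact: mscaled.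
rewrite (mulrC 3) (EFinM c) lee_wpmul2l ?lee_fin//.
rewrite ge0_integralD//; [|exact: s0|exact: mscaled].
rewrite ge0_integralD//; [|exact: s0|exact: mscaled|exact: s0|exact: mscaled].
rewrite (_ : 3%:E = 1 + 1 + 1)%E; last by rewrite -!EFinD; congr EFin; ring.
by rewrite !leeD ?scaled_le1.
Qed.

End young.

(** * The operator on a ball *)

Section ball_averages.
Context {R : realType} {n : nat}.
Implicit Types (f : 'rV[R]_n -> R) (p r : R) (phi : R -> R) (a : 'rV[R]_n).
Local Notation mu := (@lebesgue_rV R n).

Lemma lebesgue_rV_eballE a r : 0 < r -> exists2 m : R,
  mu (eball a r) = m%:E & (2 / n.+1%:R * r) ^+ n <= m <= (2 * r) ^+ n.
Proof.
move=> r0; have := lebesgue_rV_eball_le a r (ltW r0); have := lebesgue_rV_eball_ge a r r0.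
case: (mu _) => [m| |]; rewrite ?leNye_eq ?leye_eq//.
by rewrite !lee_fin => m1 m2; exists m => //; rewrite m1.
Qed.

Lemma lebesgue_rV_eball_gt0 a r m : 0 < r -> mu (eball a r) = m%:E -> 0 < m.
Proof.
move=> r0 mE; rewrite -lte_fin -mE; apply: lt_le_trans (lebesgue_rV_eball_ge a r r0).
by rewrite lte_fin exprn_gt0// mulr_gt0// divr_gt0.
Qed.

(** Since balls have positive finite measure, the supremum, the average and the root can be traded
    for one inequality per ball. The estimates on the operator take [f] and return its image in this
    form. *)
Lemma gmorrey_norm_leP p phi f (N : R) : 0 < p -> (forall r, 0 < r -> 0 < phi r) ->
  0 <= N ->
  (gmorrey_norm p phi f <= N%:E)%E <->
  forall a r, 0 < r -> (\int[mu]_(x in eball a r) (`|f x| `^ p)%:E <=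
    ((phi r * N) `^ p)%:E * mu (eball a r))%E.
Proof.
move=> p0 phi0 N0.
suff eqv a r : 0 < r -> (((phi r)^-1)%:E * ((mu (eball a r))^-1 *
      \int[mu]_(x in eball a r) (`|f x| `^ p)%:E) `^ p^-1 <= N%:E)%E =
    (\int[mu]_(x in eball a r) (`|f x| `^ p)%:E <=
    ((phi r * N) `^ p)%:E * mu (eball a r))%E.
  split=> [h a r r0|h].
    rewrite -eqv//; apply: le_trans h; apply: ereal_sup_ubound.
    by exists a => //; exists r => //=; rewrite in_itv/= r0.
  apply: ge_ereal_sup => _ [a _ [r rI <-]]; move: rI.
  by rewrite /= in_itv/= andbT => r0; rewrite eqv// h.
move=> r0; have [m mE _] := lebesgue_rV_eballE a r r0.
have m0 := lebesgue_rV_eball_gt0 _ _ _ r0 mE; rewrite mE inver gt_eqF//.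
have : (0 <= \int[mu]_(x in eball a r) (`|f x| `^ p)%:E)%E.
  by apply: integral_ge0 => x _; rewrite lee_fin powR_ge0.
have phir := phi0 _ r0.
case: (integral _ _ _) => [I| |]// I0; last first.
  (* An infinite integral makes both inequalities false. *)
  rewrite gt0_muley ?lte_fin ?invr_gt0// poweRyr ?invr_neq0 ?gt_eqF//.
  by rewrite gt0_muley ?lte_fin ?invr_gt0// !leye_eq.
rewrite -(EFinM m^-1 I) poweR_EFin -!EFinM !lee_fin mulrC ler_pdivrMr//.
rewrite lee_fin in I0; rewrite powR_inv_le ?mulr_ge0 ?invr_ge0 ?(ltW m0) ?(ltW phir)//.
by rewrite mulrC ler_pdivrMr// [N * _]mulrC.
Qed.

(** Replaces Jensen's inequality at the cost of a factor 2: |f| <= l + l (|f|/l)^p pointwise, and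
    each term integrates to at most l times the measure of the ball. *)
Lemma integral_eball_abs_le p f a r (l : R) : 1 <= p -> 0 < l ->
  measurable_fun setT f ->
  (\int[mu]_(x in eball a r) (`|f x| `^ p)%:E <= (l `^ p)%:E * mu (eball a r))%E ->
  (\int[mu]_(x in eball a r) (`|f x|)%:E <= (2 * l)%:E * mu (eball a r))%E.
Proof.
move=> p1 l0 mf fl; have lp0 : 0 < l `^ p by rewrite powR_gt0.
have mfp : measurable_fun (eball a r) (fun x => (`|f x| `^ p)%:E).
  apply: measurable_funTS; apply: (measurable_EFinP _ _).2.
  by apply: (measurableT_comp (measurable_powR p)); exact: measurableT_comp.
apply: (@le_trans _ _ (\int[mu]_(x in eball a r)
    (cst l%:E x + (l / l `^ p)%:E * (`|f x| `^ p)%:E))%E).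
  apply: ge0_le_integral_lower => // x _.
    by rewrite adde_ge0 ?mule_ge0 ?lee_fin ?divr_ge0 ?powR_ge0 ?(ltW l0).
  rewrite lee_fin normr_ge0/= -EFinM -EFinD lee_fin.
  have [fxl|/ltW lfx] := leP `|f x| l.
    by rewrite (le_trans fxl)// lerDl mulr_ge0 ?divr_ge0 ?powR_ge0 ?(ltW l0).
  have fE : `|f x| = l * (`|f x| / l) by rewrite mulrC divfK ?gt_eqF.
  have -> : l / l `^ p * `|f x| `^ p = l * (`|f x| / l) `^ p.
    rewrite powRM ?invr_ge0 ?(ltW l0)// -(powR_inv1 (ltW l0)) -powRrM mulN1r powRN.
    by rewrite -mulrA [_^-1 * _]mulrC.
  apply: (@le_trans _ _ (l * (`|f x| / l) `^ p)); last by rewrite lerDr ltW.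
  by rewrite {1}fE ler_wpM2l ?(ltW l0)// le1r_powR// ler_pdivlMr// mul1r.
have mb := measurable_eball a r.
rewrite ge0_integralD//; last 3 first.
- by move=> x _; rewrite lee_fin ltW.
- by move=> x _; rewrite mule_ge0 ?lee_fin ?divr_ge0 ?powR_ge0 ?(ltW l0).
- exact: emeasurable_funM.
rewrite integral_cst// ge0_integralZl_EFin ?divr_ge0 ?powR_ge0 ?(ltW l0)//.
  rewrite mulrDl mul1r EFinD ge0_muleDl ?lee_fin ?(ltW l0)// leeD//.
  apply: (@le_trans _ _ ((l / l `^ p)%:E * ((l `^ p)%:E * mu (eball a r)))%E).
    by rewrite lee_wpmul2l ?lee_fin ?divr_ge0 ?powR_ge0 ?(ltW l0).
  by rewrite muleA -EFinM divfK ?gt_eqF.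
Qed.

End ball_averages.

(** * Contribution of the complement of the doubled ball *)

Section far_part.
Context {R : realType} {n : nat}.
Variables (alpha gamma p tau Cd Cs : R) (phi : R -> R).
Hypotheses (halpha : 0 < alpha < n%:R) (hgamma : 0 <= gamma) (p1 : 1 <= p).
Hypothesis htau : n%:R - alpha <= tau <= n%:R - alpha + gamma.
Hypothesis taun : tau <= n%:R.
Hypothesis phi_gt0 : forall r, 0 < r -> 0 < phi r.
Hypothesis Cd0 : 0 < Cd.
Hypothesis phi_almost_decr : forall r r', 0 < r -> r <= r' -> Cd * phi r' <= phi r.
Hypothesis Cs0 : 0 < Cs.
Hypothesis phi_sum : forall r k, 0 < r ->
  \sum_(i < k) phi (2 ^+ i.+1 * r) * (2 ^+ i * r) `^ (n%:R - tau) <=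
  Cs * (phi r * r `^ (n%:R - tau)).
Implicit Types (x y a : 'rV[R]_n) (f : 'rV[R]_n -> R) (r N : R).
Local Notation mu := (@lebesgue_rV R n).
Local Notation K := (bessel_riesz_kernel n alpha gamma).

Lemma measurable_kernel_mul f x : measurable_fun setT f ->
  measurable_fun setT (fun y => K (x - y) * f y).
Proof.
move=> mf; apply: measurable_funM => //.
apply: measurableT_comp; first exact: measurable_bessel_riesz_kernel.
exact: measurable_rV_sub.
Qed.

Lemma far_part_le : exists2 M, 0 < M & forall f N, 0 < N ->
  measurable_fun setT f ->
  (forall a r, 0 < r -> (\int[mu]_(x in eball a r) (`|f x| `^ p)%:E <=
    ((phi r * N) `^ p)%:E * mu (eball a r))%E) ->
  forall a r x, 0 < r -> eball a r x ->
  (\int[mu]_(y in ~` eball a (2 * r)) (K (x - y) * `|f y|)%:E <=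
   (M * (phi r * r `^ (n%:R - tau) * N))%:E)%E.
Proof.
have tau0 : 0 < tau by move: halpha htau => /andP[? ?] /andP[? _]; lra.
(* 2 comes from [integral_eball_abs_le], 8^n from the cube around the ball of radius 2^(k+2) r. As
   the shells start at 2r, [phi_sum] is applied there; the power of 2 and [Cd] bring the result back
   to radius r. *)
exists (2 * 8 ^+ n * (Cs * 2 `^ (n%:R - tau) / Cd)).
  by rewrite !mulr_gt0 ?exprn_gt0 ?powR_gt0 ?invr_gt0.
move=> f N N0 mf hf a r x r0 xa.
have r2 k : 0 < 2 ^+ k * (2 * r) by rewrite !mulr_gt0 ?exprn_gt0.
have r1 k : 0 < 2 ^+ k * r by rewrite mulr_gt0 ?exprn_gt0.
pose B k := eball a (2 ^+ k.+1 * (2 * r)) `\` eball a (2 ^+ k * (2 * r)).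
pose m k := 2 * 8 ^+ n * N *
  (phi (2 ^+ k.+1 * (2 * r)) * (2 ^+ k * r) `^ (n%:R - tau)).
apply: (@ge0_integral_cover_le _ _ _ mu _ B _ m).
- by move=> k; apply: measurableD; exact: measurable_eball.
- apply: (measurable_EFinP _ _).2.
  by apply: measurable_kernel_mul; exact: measurableT_comp.
- by move=> y; rewrite lee_fin mulr_ge0 ?bessel_riesz_kernel_ge0.
- move=> y /negP; rewrite -leNgt => ya _.
  have [|k /andP[k1 k2]] := dyadic_bracket (enorm (y - a) / (2 * r)).
    by rewrite ler_pdivlMr ?mul1r ?mulr_gt0.
  exists k; split; first by rewrite /eball/= -ltr_pdivrMr// mulr_gt0.
  by apply/negP; rewrite -leNgt -ler_pdivlMr// mulr_gt0.
- move=> k; set rho := 2 ^+ k.+1 * (2 * r); set v := (2 ^+ k * r) `^ (- tau).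
  have rho0 : 0 < rho by exact: r2.
  have v0 : 0 <= v by exact: powR_ge0.
  apply: (@le_trans _ _ (\int[mu]_(y in eball a rho) (v%:E * (`|f y|)%:E))%E).
    apply: ge0_le_integral_lower; first by move=> y [].
      by move=> y _; rewrite mule_ge0.
    move=> y [_ /negP]; rewrite -leNgt => ya.
    rewrite -EFinM !lee_fin mulr_ge0 ?bessel_riesz_kernel_ge0//= ler_wpM2r//.
    apply: le_trans (bessel_riesz_kernel_le_powR _ _ halpha hgamma _ _ htau) _.
    (* |y - a| >= 2^(k+1) r on the shell, while |x - a| < r <= 2^k r. *)
    have xy : 2 ^+ k * r <= enorm (x - y).
      have := ler_enormB_add y a x; rewrite (enormC y x) (enormC a x).
      have := ler_wpM2r (ltW r0) (exprn_ege1 k (ler1n R 2)).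
      by move: xa ya; rewrite /eball/=; lra.
    rewrite /v !powRN lef_pV2 ?posrE ?powR_gt0//; last exact: lt_le_trans xy.
    by rewrite ge0_ler_powR ?nnegrE ?enorm_ge0 ?(ltW (r1 _)) ?(ltW tau0).
  rewrite ge0_integralZl_EFin//; [|exact: measurable_eball|]; last first.
    apply: measurable_funTS; apply: (measurable_EFinP _ _).2.
    exact: measurableT_comp.
  have phiN0 : 0 < phi rho * N by rewrite mulr_gt0 ?phi_gt0.
  apply: (@le_trans _ _ (v%:E * ((2 * (phi rho * N))%:E * ((2 * rho) ^+ n)%:E))%E).
    rewrite lee_wpmul2l ?lee_fin//.
    apply: le_trans (integral_eball_abs_le _ _ _ _ _ p1 phiN0 mf (hf _ _ rho0)) _.
    rewrite lee_wpmul2l ?lebesgue_rV_eball_le ?(ltW rho0)//.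
    by rewrite lee_fin mulr_ge0// ltW.
  rewrite -!EFinM lee_fin /m le_eqVlt; apply/orP; left; apply/eqP.
  have -> : 2 * rho = 8 * (2 ^+ k * r) by rewrite /rho exprS; ring.
  rewrite exprMn addrC powRD; last by rewrite (gt_eqF (r1 k)) implybT.
  rewrite powR_mulrn; last by rewrite ltW.
  by rewrite -/v -/rho; ring.
- move=> k; rewrite -mulr_sumr -!mulrA !ler_wpM2l ?exprn_ge0//.
  apply: (@le_trans _ _ (N * (Cs * (phi (2 * r) * (2 * r) `^ (n%:R - tau))))).
    rewrite ler_wpM2l ?(ltW N0)//; apply: le_trans (phi_sum _ k _); last by rewrite mulr_gt0.
    apply: ler_sum => i _; rewrite ler_wpM2l ?(ltW (phi_gt0 _ _))//.
    rewrite ge0_ler_powR ?nnegrE ?(ltW (r1 _)) ?(ltW (r2 _)) ?subr_ge0//.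
    by rewrite ler_wpM2l ?exprn_ge0// ler_peMl ?ler1n// ltW.
  rewrite powRM ?(ltW r0)//.
  have : phi (2 * r) <= phi r / Cd.
    by rewrite ler_pdivlMr// mulrC phi_almost_decr// ler_peMl ?ler1n// ltW.
  have : 0 <= N * Cs * (2 `^ (n%:R - tau) * r `^ (n%:R - tau)).
    by rewrite !mulr_ge0 ?powR_ge0// ltW.
  move=> h1 h2; have := ler_wpM2l h1 h2; congr (_ <= _); ring.
Qed.

End far_part.

(** * Tonelli's theorem on product sets, by extension by zero *)

Section fubini_sets.
Context d1 d2 (T1 : measurableType d1) (T2 : measurableType d2) (R : realType).
Variables (m1 : {sigma_finite_measure set T1 -> \bar R}).
Variables (m2 : {sigma_finite_measure set T2 -> \bar R}).
Variables (A : set T1) (B : set T2) (g : T1 * T2 -> \bar R).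
Hypotheses (mA : measurable A) (mB : measurable B) (mg : measurable_fun setT g).
Hypothesis g0 : forall x, (0 <= g x)%E.

Lemma measurable_fun_integral_set :
  measurable_fun setT (fun x => \int[m2]_(y in B) g (x, y))%E.
Proof.
have mgB : measurable_fun setT (g \_ (setT `*` B)).
  apply/(measurable_restrictT _ _).1; last exact: measurable_funS mg.
  exact: measurableX.
have gB0 z : (0 <= (g \_ (setT `*` B)) z)%E by exact: erestrict_ge0.
have := measurable_fun_fubini_tonelli_F (m2 := m2) _ mgB gB0.
rewrite /fubini_F; congr (measurable_fun _ _); apply/funext => x.
rewrite [RHS]integral_mkcond; apply: eq_integral => y _.
by rewrite /patch in_setX in_setT.
Qed.

Lemma fubini_tonelli_sets :
  (\int[m1]_(x in A) \int[m2]_(y in B) g (x, y) =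
   \int[m2]_(y in B) \int[m1]_(x in A) g (x, y))%E.
Proof.
have mgAB : measurable_fun setT (g \_ (A `*` B)).
  apply/(measurable_restrictT _ _).1; last exact: measurable_funS mg.
  exact: measurableX.
have gAB0 z : (0 <= (g \_ (A `*` B)) z)%E by exact: erestrict_ge0.
have := fubini_tonelli (m1 := m1) (m2 := m2) _ mgAB gAB0.
rewrite [LHS in _ -> LHS = _]integral_mkcond [RHS in _ -> _ = RHS]integral_mkcond.
congr (_ = _); apply: eq_integral => z _; rewrite [RHS]patchE.
- case: ifPn => zA; last by rewrite integral0_eq// => y _; rewrite patchE in_setX (negbTE zA).
  by rewrite [RHS]integral_mkcond; apply: eq_integral => y _; rewrite !patchE in_setX zA.
- case: ifPn => zB; last first.
    by rewrite integral0_eq// => y _; rewrite patchE in_setX (negbTE zB) andbF.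
  by rewrite [RHS]integral_mkcond; apply: eq_integral => y _; rewrite !patchE in_setX zB andbT.
Qed.

End fubini_sets.

(** One finite bound on the integral of |g| gives both the convergence and the size of the
    potential. *)
Lemma normr_Rintegral_le d (T : measurableType d) (R : realType)
    (mu : {measure set T -> \bar R}) (D : set T) (g : T -> R) (z : R) :
  measurable D -> measurable_fun D g ->
  (\int[mu]_(x in D) (`|g x|)%:E <= z%:E)%E ->
  mu.-integrable D (EFin \o g) /\ `|Rintegral mu D g| <= z.
Proof.
move=> mD mg gz; have ig : mu.-integrable D (EFin \o g).
  apply/integrableP; split; first exact: (measurable_EFinP _ _).2.
  by apply: le_lt_trans gz _; rewrite ltry.
split => //; apply: le_trans (le_normr_Rintegral mD ig) _.
rewrite -lee_fin /Rintegral fineK//.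
rewrite ge0_fin_numE; first by apply: le_lt_trans gz _; rewrite ltry.
by apply: integral_ge0 => x _; rewrite lee_fin.
Qed.

Lemma powRD_le (R : realType) (u v q : R) : 0 <= q -> 0 <= u -> 0 <= v ->
  (u + v) `^ q <= 2 `^ q * (u `^ q + v `^ q).
Proof.
move=> q0; wlog uv : u v / u <= v => [wlg|u0 v0].
  by case/orP: (le_total u v) => h *; [|rewrite addrC [X in _ * X]addrC]; exact: wlg.
apply: (@le_trans _ _ ((2 * v) `^ q)).
  by rewrite ge0_ler_powR ?nnegrE ?addr_ge0 ?mulr_ge0//; lra.
by rewrite powRM// ler_wpM2l ?powR_ge0// lerDr powR_ge0.
Qed.

(** * Contribution of the doubled ball *)

Section local_part.
Context {R : realType} {n : nat}.
Variables (alpha gamma p q s tau A : R).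
Hypotheses (halpha : 0 < alpha < n%:R) (hgamma : 0 <= gamma).
Hypotheses (p1 : 1 <= p) (s1 : 1 <= s) (q0 : 0 < q).
Hypothesis qE : q^-1 = p^-1 + s^-1 - 1.
Implicit Types (x y a : 'rV[R]_n) (f : 'rV[R]_n -> R) (r N : R).
Local Notation mu := (@lebesgue_rV R n).
Local Notation K := (bessel_riesz_kernel n alpha gamma).
Hypothesis A0 : 0 < A.
Hypothesis hA : forall y r, 0 < r ->
  (\int[mu]_(x in eball y r) (K (x - y) `^ s)%:E <=
   (A * r `^ (n%:R - tau * s))%:E)%E.

Lemma measurable_kernel_integrand (f : 'rV[R]_n -> R) : measurable_fun setT f ->
  measurable_fun setT (fun z : 'rV[R]_n * 'rV[R]_n => K (z.1 - z.2) `^ s * f z.2).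
Proof.
move=> mf; apply: measurable_funM; last exact: measurableT_comp.
apply: (measurableT_comp (measurable_powR s)); apply: measurableT_comp.
  exact: measurable_bessel_riesz_kernel.
by apply: measurable_rV_sub; [exact: measurable_fst|exact: measurable_snd].
Qed.

(** The one factor of the Young bound that is not controlled uniformly in [x]. It takes values in
    [\bar R] because it may be infinite at some points; only its integral over B(a,r) is bounded. *)
Definition local_potential f a r x :=
  (\int[mu]_(y in eball a (2 * r)) (K (x - y) `^ s * `|f y| `^ p)%:E)%E.

Lemma local_potential_ge0 f a r x : (0 <= local_potential f a r x)%E.
Proof. by apply: integral_ge0 => y _; rewrite lee_fin mulr_ge0 ?powR_ge0. Qed.

Section fixed_function.
Variables (f : 'rV[R]_n -> R) (F : R) (a : 'rV[R]_n) (r : R).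
Hypotheses (mf : measurable_fun setT f) (r0 : 0 < r) (F0 : 0 < F).
Hypothesis hF : (\int[mu]_(y in eball a (2 * r)) (`|f y| `^ p)%:E <= F%:E)%E.
(** Radius 3r, because points of B(a,r) and B(a,2r) are less than 3r apart. *)
Let A' := A * (3 * r) `^ (n%:R - tau * s).

Let mfp : measurable_fun setT (fun y => `|f y| `^ p).
Proof. by apply: (measurableT_comp (measurable_powR p)); exact: measurableT_comp. Qed.

Let mg : measurable_fun setT
  (fun z : 'rV[R]_n * 'rV[R]_n => (K (z.1 - z.2) `^ s * `|f z.2| `^ p)%:E).
Proof. by apply: (measurable_EFinP _ _).2; exact: (measurable_kernel_integrand _ mfp). Qed.

Lemma measurable_local_potential : measurable_fun setT (local_potential f a r).
Proof.
apply: (@measurable_fun_integral_set _ _ _ _ _ mu _ _ _ mg).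
  exact: measurable_eball.
by move=> z; rewrite lee_fin mulr_ge0 ?powR_ge0.
Qed.

(** Tonelli puts the integral in [x] inside, where [hA] centred at [y] bounds it by the same
    constant for every [y]. *)
Lemma integral_local_potential_le :
  (\int[mu]_(x in eball a r) local_potential f a r x <= (A' * F)%:E)%E.
Proof.
have -> := @fubini_tonelli_sets _ _ _ _ _ mu mu (eball a r) (eball a (2 * r))
  _ (measurable_eball _ _) (measurable_eball _ _) mg _; last first.
  by move=> z; rewrite lee_fin mulr_ge0 ?powR_ge0.
apply: (@le_trans _ _ (\int[mu]_(y in eball a (2 * r)) (A'%:E * (`|f y| `^ p)%:E))%E).
  apply: ge0_le_integral_lower => // y ya.
    by rewrite -EFinM lee_fin !mulr_ge0 ?powR_ge0 ?(ltW A0).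
  rewrite integral_ge0/=; last by move=> x _; rewrite lee_fin mulr_ge0 ?powR_ge0.
  under eq_integral do rewrite EFinM.
  rewrite ge0_integralZr//; last 3 first.
  - exact: measurable_eball.
  - by apply: measurable_funTS; exact: measurable_bessel_riesz_kernel_powR.
  - by move=> x _; rewrite lee_fin powR_ge0.
  rewrite lee_wpmul2r ?lee_fin ?powR_ge0//.
  apply: (@le_trans _ _ (\int[mu]_(x in eball y (3 * r)) (K (x - y) `^ s)%:E)%E).
    apply: ge0_le_integral_lower => [|x _|x _]; rewrite ?lee_fin ?powR_ge0 ?lexx//.
    by apply: subset_eball; rewrite enormC; move: ya; rewrite /eball/=; lra.
  by apply: hA; rewrite mulr_gt0.
have mb := measurable_eball a (2 * r).
have A'0 : 0 <= A' by rewrite mulr_ge0 ?powR_ge0 ?(ltW A0).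
rewrite ge0_integralZl_EFin//; last first.
  by apply: measurable_funTS; exact: (measurable_EFinP _ _).2.
by rewrite (EFinM A') lee_wpmul2l.
Qed.

(** Here [x] is the centre and [y] the variable of integration: the symmetry of the kernel lets [hA]
    apply to the second variable too. *)
Lemma local_part_le x (d : R) : eball a r x -> 0 < d ->
  (local_potential f a r x <= d%:E)%E ->
  (\int[mu]_(y in eball a (2 * r)) (K (x - y) * `|f y|)%:E <=
   (3 * (d `^ q^-1 * A' `^ (1 - p^-1) * F `^ (1 - s^-1)))%:E)%E.
Proof.
move=> xa d0 fd.
apply: (young_integral_le _ _ _ _ (fun y => K (x - y)) (fun y => `|f y|) p q s) => //.
- exact: measurable_eball.
- apply: measurableT_comp; first exact: measurable_bessel_riesz_kernel.
  exact: measurable_rV_sub.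
- exact: measurableT_comp.
- by move=> y; exact: bessel_riesz_kernel_ge0.
- by rewrite mulr_gt0 ?powR_gt0 ?mulr_gt0.
- apply: (@le_trans _ _ (\int[mu]_(y in eball x (3 * r)) (K (y - x) `^ s)%:E)%E).
    apply: ge0_le_integral_lower => [|y _|y _].
    + by apply: subset_eball; rewrite enormC; move: xa; rewrite /eball/=; lra.
    + by rewrite lee_fin powR_ge0.
    + by rewrite bessel_riesz_kernelC !lee_fin powR_ge0/=.
  by apply: hA; rewrite mulr_gt0.
Qed.

End fixed_function.
End local_part.

(** * Combination of the two contributions *)

Section young_constants.
Context {R : realType}.

(** The extra factor A F is the bound on the integral of the local potential. Since q(1 - 1/p) + 1 =
    q/s and q(1 - 1/s) + 1 = q/p, the usual Young product of an L^s bound A^(1/s) and an L^p bound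
    F^(1/p) reappears. *)
Lemma young_exponents (p q s A F : R) : 0 < A -> 0 < F -> 0 < q ->
  q^-1 = p^-1 + s^-1 - 1 ->
  (A `^ (1 - p^-1) * F `^ (1 - s^-1)) `^ q * (A * F) =
  (A `^ s^-1 * F `^ p^-1) `^ q.
Proof.
move=> A0 F0 q0 qE.
have step (z b c : R) : 0 < z -> q^-1 = c + b - 1 ->
    (z `^ (1 - b)) `^ q * z = (z `^ c) `^ q.
  move=> z0 bE; rewrite -[in X in _ * X](powRr1 (ltW z0)) -!powRrM -powRD.
    congr powR; rewrite [c](_ : _ = q^-1 + (1 - b)); last by rewrite bE; ring.
    by rewrite [in RHS]mulrDl mulVf ?gt_eqF// addrC.
  by rewrite (gt_eqF z0) implybT.
rewrite !powRM ?powR_ge0// -(step A p^-1 s^-1)// ?[s^-1 + _]addrC//.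
by rewrite -(step F s^-1 p^-1)// mulrACA.
Qed.

End young_constants.

Section operator.
Context {R : realType} {n : nat}.
Variables (alpha gamma p q s tau A Cd Cs : R) (phi : R -> R).
Hypotheses (halpha : 0 < alpha < n%:R) (hgamma : 0 <= gamma).
Hypotheses (p1 : 1 <= p) (s1 : 1 <= s) (q0 : 0 < q).
Hypothesis qE : q^-1 = p^-1 + s^-1 - 1.
Hypothesis htau : n%:R - alpha <= tau <= n%:R - alpha + gamma.
Hypothesis taun : tau <= n%:R.
Implicit Types (x y a : 'rV[R]_n) (f : 'rV[R]_n -> R) (r N : R).
Local Notation mu := (@lebesgue_rV R n).
Local Notation K := (bessel_riesz_kernel n alpha gamma).
Hypothesis A0 : 0 < A.
Hypothesis hA : forall y r, 0 < r ->
  (\int[mu]_(x in eball y r) (K (x - y) `^ s)%:E <=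
   (A * r `^ (n%:R - tau * s))%:E)%E.
Hypothesis phi_gt0 : forall r, 0 < r -> 0 < phi r.
Hypothesis Cd0 : 0 < Cd.
Hypothesis phi_almost_decr : forall r r', 0 < r -> r <= r' -> Cd * phi r' <= phi r.
Hypothesis Cs0 : 0 < Cs.
Hypothesis phi_sum : forall r k, 0 < r ->
  \sum_(i < k) phi (2 ^+ i.+1 * r) * (2 ^+ i * r) `^ (n%:R - tau) <=
  Cs * (phi r * r `^ (n%:R - tau)).

Let p0 : 0 < p. Proof. exact: lt_le_trans p1. Qed.
Let s0 : 0 < s. Proof. exact: lt_le_trans s1. Qed.

Let A_ r := A * (3 * r) `^ (n%:R - tau * s).
(** Bounds the integral of |f|^p over B(a,2r): phi(2r) is at most [phi r / Cd], and a cube of side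
    4r contains the ball. *)
Let F_ r N := (phi r / Cd * N) `^ p * (4 * r) ^+ n.
Let H_ r N := A_ r `^ (1 - p^-1) * F_ r N `^ (1 - s^-1).
Let c1 := A `^ s^-1 * 3 `^ (n%:R / s - tau) * Cd^-1 * 4 `^ (n%:R / p).

(** The powers of r balance: by [qE], n/s - tau + n/p = n - tau + n/q. The part n/q turns into r^n,
    the volume of the ball up to a constant, and r^(n - tau) is the power in psi. *)
Lemma local_constantE r N : 0 < r -> 0 < N ->
  H_ r N `^ q * (A_ r * F_ r N) =
  (c1 * (phi r * r `^ (n%:R - tau) * N)) `^ q * r ^+ n.
Proof.
move=> r0 N0; have G0 : 0 < phi r / Cd * N by rewrite !mulr_gt0 ?phi_gt0 ?invr_gt0.
rewrite young_exponents//; last 2 first.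
- by rewrite mulr_gt0 ?powR_gt0 ?mulr_gt0.
- by rewrite mulr_gt0 ?(powR_gt0 _ G0) ?exprn_gt0 ?mulr_gt0.
have -> : A_ r `^ s^-1 = A `^ s^-1 * 3 `^ (n%:R / s - tau) * r `^ (n%:R / s - tau).
  rewrite /A_ powRM ?powR_ge0 ?(ltW A0)// -powRrM mulrBl mulfK ?gt_eqF//.
  by rewrite powRM ?(ltW r0)// mulrA.
have -> : F_ r N `^ p^-1 = phi r / Cd * N * (4 `^ (n%:R / p) * r `^ (n%:R / p)).
  rewrite /F_ powRM ?powR_ge0 ?exprn_ge0 ?mulr_ge0 ?(ltW r0)// -powRrM mulfV ?gt_eqF//.
  rewrite powRr1 ?(ltW G0)// -powR_mulrn ?mulr_ge0 ?(ltW r0)// -powRrM.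
  by rewrite powRM ?(ltW r0).
have rnE : r ^+ n = (r `^ (n%:R / q)) `^ q.
  by rewrite -powRrM divfK ?gt_eqF// powR_mulrn// ltW.
have rE : r `^ (n%:R / s - tau) * r `^ (n%:R / p) =
    r `^ (n%:R - tau) * r `^ (n%:R / q).
  rewrite -!powRD ?(gt_eqF r0) ?implybT//; congr powR; rewrite qE; ring.
rewrite rnE -[RHS]powRM ?powR_ge0//; last first.
  by rewrite !mulr_ge0 ?powR_ge0 ?invr_ge0 ?(ltW Cd0) ?(ltW N0) ?(ltW (phi_gt0 _ _)).
congr (_ `^ q); rewrite /c1.
transitivity (A `^ s^-1 * 3 `^ (n%:R / s - tau) * (phi r / Cd * N) * 4 `^ (n%:R / p)
   * (r `^ (n%:R / s - tau) * r `^ (n%:R / p))); first by ring.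
by rewrite rE; ring.
Qed.

(** On B(a,r) the potential is at most a constant plus a multiple of d^(1/q), with d a positive
    bound for the local potential at the point. The q-th power is then controlled by an affine
    function of d, so the integral of the local potential is all that is needed. *)
Lemma bessel_riesz_le : exists2 M, 0 < M & forall f N, 0 < N ->
  measurable_fun setT f ->
  (forall a r, 0 < r -> (\int[mu]_(x in eball a r) (`|f x| `^ p)%:E <=
    ((phi r * N) `^ p)%:E * mu (eball a r))%E) ->
  bessel_riesz_defined alpha gamma f /\
  forall a r, 0 < r -> (\int[mu]_(x in eball a r) (`|bessel_riesz alpha gamma f x| `^ q)%:E <=
    ((phi r * r `^ (n%:R - tau) * (M * N)) `^ q)%:E * mu (eball a r))%E.
Proof.
have [M2 M20 hM2] := @far_part_le R n alpha gamma p tau Cd Cs phi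
  halpha hgamma p1 htau taun phi_gt0 Cd0 phi_almost_decr Cs0 phi_sum.
pose c : R := (2 / n.+1%:R) ^+ n.
have c0 : 0 < c by rewrite exprn_gt0// divr_gt0.
have c10 : 0 < c1 by rewrite !mulr_gt0 ?powR_gt0 ?invr_gt0.
(* 2^q comes from [powRD_le], 3^q from the Young bound, [c^-1] from comparing r^n with the measure
   of the ball, the inner 2 from [delta] below, and [M2] from the far part. *)
pose Mq := 2 `^ q * (3 `^ q * (c1 `^ q * c^-1 * 2) + M2 `^ q).
have Mq0 : 0 < Mq by rewrite mulr_gt0 ?addr_gt0 ?mulr_gt0 ?powR_gt0 ?invr_gt0.
exists (Mq `^ q^-1); first by rewrite powR_gt0.
move=> f N N0 mf hf.
have mnf : measurable_fun setT (fun y => `|f y|) by exact: measurableT_comp.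
have F_gt0 r : 0 < r -> 0 < F_ r N.
  by move=> r0; rewrite mulr_gt0 ?powR_gt0 ?exprn_gt0 ?mulr_gt0 ?phi_gt0 ?invr_gt0.
have A_gt0 r : 0 < r -> 0 < A_ r by move=> r0; rewrite mulr_gt0 ?powR_gt0 ?mulr_gt0.
have hF a r : 0 < r ->
    (\int[mu]_(y in eball a (2 * r)) (`|f y| `^ p)%:E <= (F_ r N)%:E)%E.
  move=> r0; have r20 : 0 < 2 * r by rewrite mulr_gt0.
  apply: le_trans (hf a _ r20) _; rewrite /F_ EFinM.
  rewrite lee_pmul ?lee_fin ?powR_ge0//; last first.
    by apply: le_trans (lebesgue_rV_eball_le _ _ (ltW r20)) _; rewrite mulrA -natrM.
  have ph : phi (2 * r) <= phi r / Cd.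
    by rewrite ler_pdivlMr// mulrC phi_almost_decr// ler_peMl ?ler1n// ltW.
  rewrite ge0_ler_powR ?nnegrE ?(ltW p0) ?mulr_ge0 ?invr_ge0 ?(ltW N0) ?(ltW Cd0)//.
  - by rewrite ltW ?phi_gt0.
  - by rewrite ltW ?phi_gt0.
  - by rewrite ler_wpM2r ?(ltW N0).
pose P r := M2 * (phi r * r `^ (n%:R - tau) * N).
have P0 r : 0 < r -> 0 < P r by move=> r0; rewrite !mulr_gt0 ?powR_gt0 ?phi_gt0.
have pointwise a r x (d : R) : 0 < r -> eball a r x -> 0 < d ->
    (local_potential alpha gamma p s f a r x <= d%:E)%E ->
    mu.-integrable setT (EFin \o bessel_riesz_integrand alpha gamma f x) /\
    `|bessel_riesz alpha gamma f x| <= 3 * (d `^ q^-1 * H_ r N) + P r.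
  move=> r0 xa d0 hd; apply: normr_Rintegral_le => //.
    exact: measurable_kernel_mul.
  apply: (@le_trans _ _ (\int[mu]_(y in eball a (2 * r) `|` ~` eball a (2 * r))
      (K (x - y) * `|f y|)%:E)%E).
    apply: ge0_le_integral_lower => [y _|y _|y _]; first by rewrite setUv.
    - by rewrite lee_fin mulr_ge0 ?bessel_riesz_kernel_ge0.
    - by rewrite !lee_fin normr_ge0/= normrM ger0_norm ?bessel_riesz_kernel_ge0.
  rewrite ge0_integral_setU; first last.
  - by apply/disj_setPS => y [].
  - by move=> y _; rewrite lee_fin mulr_ge0 ?bessel_riesz_kernel_ge0.
  - rewrite setUv; apply: (measurable_EFinP _ _).2.
    exact: measurable_kernel_mul.
  - by apply: measurableC; exact: measurable_eball.
  - exact: measurable_eball.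
  rewrite EFinD leeD//; last exact: hM2.
  rewrite /H_ [X in 3 * X]mulrA.
  exact: (local_part_le _ _ _ _ _ _ _ p1 s1 q0 qE A0 hA _ _ _ _ mf r0
    (F_gt0 _ r0) (hF _ _ r0) _ _ xa d0 hd).
have ID a r : 0 < r ->
    (\int[mu]_(x in eball a r) local_potential alpha gamma p s f a r x <=
      (A_ r * F_ r N)%:E)%E.
  move=> r0; exact: (integral_local_potential_le _ _ _ _ _ _ A0 hA _ _ _ _ mf r0 (hF _ _ r0)).
split.
  (* The balls B(0,k+1) exhaust the space, and on each of them the local potential is integrable,
     hence finite almost everywhere. *)
  have aeD k : {ae mu, forall x, eball 0 k.+1%:R x ->
      local_potential alpha gamma p s f 0 k.+1%:R x \is a fin_num}.
    have k0 : 0 < k.+1%:R :> R by rewrite ltr0n.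
    apply: integrable_ae; first exact: measurable_eball.
    apply/integrableP; split.
      apply: measurable_funTS.
      exact: (measurable_local_potential alpha gamma p s f _ _ mf).
    apply: (@le_lt_trans _ _ (A_ k.+1%:R * F_ k.+1%:R N)%:E); last by rewrite ltry.
    apply: le_trans (ID 0 _ k0).
    apply: ge0_le_integral_lower => // x _; first exact: local_potential_ge0.
    by rewrite abse_ge0/= gee0_abs ?local_potential_ge0.
  apply: negligibleS (negligible_bigcup aeD) => x /= xN.
  exists (Num.truncn (enorm x)) => //= xD; apply: xN.
  set k := (Num.truncn (enorm x)).+1%:R in xD *.
  have k0 : 0 < k by rewrite ltr0n.
  have xk : eball 0 k x by rewrite /eball/= subr0 truncnS_gt.
  have Dfin := xD xk.
  (* Adding 1 makes the bound positive, as [pointwise] requires. *)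
  have D1 : 0 < fine (local_potential alpha gamma p s f 0 k x) + 1.
    by rewrite ltr_wpDl// fine_ge0// local_potential_ge0.
  have [] := pointwise 0 k x _ k0 xk D1 => //.
  by rewrite EFinD fineK// leeDl.
move=> a r r0; have [m mE /andP[cm _]] := lebesgue_rV_eballE a r r0.
have m0 := lebesgue_rV_eball_gt0 _ _ _ r0 mE.
have cm' : r ^+ n <= c^-1 * m.
  by rewrite mulrC ler_pdivlMr// mulrC -exprMn.
(* Adding delta keeps the Young bound usable where the potential vanishes;
   being its mean bound over the ball, it costs only a factor 2. *)
pose delta := A_ r * F_ r N / m.
have AF0 : 0 < A_ r * F_ r N by rewrite mulr_gt0 ?A_gt0 ?F_gt0.
have delta0 : 0 < delta by rewrite divr_gt0.
(* Slope of the affine bound in the local potential; [e3] is its constant term. *)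
pose e2 := 2 `^ q * (3 `^ q * H_ r N `^ q).
have H0 : 0 < H_ r N by rewrite mulr_gt0 ?powR_gt0 ?A_gt0 ?F_gt0.
have e20 : 0 < e2 by rewrite !mulr_gt0 ?powR_gt0.
pose e3 := e2 * delta + 2 `^ q * P r `^ q.
have e30 : 0 <= e3.
  by apply: addr_ge0; apply: mulr_ge0; rewrite ?powR_ge0 ?(ltW e20) ?(ltW delta0).
have mB := measurable_eball a r.
have mD : measurable_fun (eball a r) (local_potential alpha gamma p s f a r).
  by apply: measurable_funTS; exact: (measurable_local_potential alpha gamma p s f a r mf).
apply: (@le_trans _ _ (\int[mu]_(x in eball a r)
    (e2%:E * local_potential alpha gamma p s f a r x + cst e3%:E x))%E).
  apply: ge0_le_integral_lower => // x xa.
    by rewrite adde_ge0 ?mule_ge0 ?lee_fin ?(ltW e20) ?local_potential_ge0.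
  rewrite lee_fin powR_ge0/=.
  have := local_potential_ge0 alpha gamma p s f a r x.
  case Dx : (local_potential _ _ _ _ _ _ _ _) => [d| |]// d0; last first.
    by rewrite gt0_muley ?lte_fin// addye ?leey.
  rewrite lee_fin in d0.
  have dd0 : 0 < d + delta by rewrite ltr_wpDl.
  have [|_ hT] := pointwise a r x (d + delta) r0 xa dd0.
    by rewrite Dx lee_fin lerDl ltW.
  rewrite -EFinM -EFinD lee_fin.
  have u0 : 0 <= 3 * ((d + delta) `^ q^-1 * H_ r N).
    by rewrite mulr_ge0// mulr_ge0 ?powR_ge0 ?(ltW H0).
  apply: (@le_trans _ _ ((3 * ((d + delta) `^ q^-1 * H_ r N) + P r) `^ q)).
    rewrite ge0_ler_powR ?nnegrE ?(ltW q0)//.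
    by rewrite (addr_ge0 u0)// ltW ?P0.
  apply: le_trans (powRD_le _ _ _ _ (ltW q0) u0 (ltW (P0 _ r0))) _.
  rewrite [X in 2 `^ q * (X + _)](@powRM _ 3)//; last by rewrite mulr_ge0 ?powR_ge0 ?(ltW H0).
  rewrite (@powRM _ (_ `^ q^-1) (H_ r N)) ?powR_ge0 ?(ltW H0)//.
  rewrite -(@powRrM _ (d + delta)) mulVf ?gt_eqF//.
  rewrite powRr1 ?(ltW dd0)// /e3 /e2 le_eqVlt; apply/orP; left; apply/eqP; ring.
rewrite ge0_integralD//; last 2 first.
- by move=> x _; rewrite mule_ge0 ?lee_fin ?(ltW e20) ?local_potential_ge0.
- exact: emeasurable_funM.
rewrite integral_cst// ge0_integralZl_EFin ?(ltW e20)//; last first.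
  by move=> x _; exact: local_potential_ge0.
rewrite mE.
apply: (@le_trans _ _ (e2%:E * (A_ r * F_ r N)%:E + e3%:E * m%:E)%E).
  rewrite leeD// lee_wpmul2l//; first by rewrite lee_fin ltW.
    exact: ID.
  by rewrite -mE.
rewrite -!EFinM -EFinD lee_fin.
rewrite (_ : phi r * r `^ (n%:R - tau) * (Mq `^ q^-1 * N) =
  Mq `^ q^-1 * (phi r * r `^ (n%:R - tau) * N)); last by ring.
set Q := phi r * _ * N.
have Q0 : 0 < Q by rewrite !mulr_gt0 ?powR_gt0 ?phi_gt0.
rewrite powRM ?powR_ge0 ?(ltW Q0)// -powRrM mulVf ?gt_eqF// powRr1 ?(ltW Mq0)//.
have bound (b3 b2 bc bQ bM x : R) : 0 <= b3 -> 0 <= b2 -> 0 <= bc -> 0 <= bQ ->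
    x <= c^-1 * m ->
    b2 * (b3 * (bc * bQ * x * 2) + bM * bQ * m) <=
    b2 * (b3 * (bc * c^-1 * 2) + bM) * bQ * m.
  move=> b30 b20 bc0 bQ0 xm.
  have : 0 <= b2 * b3 * bc * bQ * 2 by rewrite !mulr_ge0.
  move=> h1; have := ler_wpM2l h1 xm; lra.
have -> : e2 * (A_ r * F_ r N) + e3 * m =
    2 `^ q * (3 `^ q * ((H_ r N `^ q * (A_ r * F_ r N)) * 2) + P r `^ q * m).
  by rewrite /e3 /e2 /delta; field; rewrite gt_eqF.
rewrite local_constantE// -/Q /P -/Q (powRM _ (ltW c10) (ltW Q0)) (powRM _ (ltW M20) (ltW Q0)).
by rewrite /Mq; apply: bound; rewrite ?powR_ge0.
Qed.

End operator.

(** * The Morrey norm of the kernel *)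

Section compact.
Context {R : realType} {n : nat}.

(** Compactness bounds the sup norm; the factor n+1 passes to the Euclidean norm, since n <
    (n+1)^2. *)
Lemma compact_sub_eball (C : set 'rV[R]_n) : compact C ->
  exists2 r, 0 < r & C `<=` eball 0 r.
Proof.
move=> /compact_bounded[N [_ hN]].
have N1 : N < `|N| + 1 by rewrite (le_lt_trans (ler_norm N))// ltrDl.
exists (n.+1%:R * (`|N| + 1)); first by rewrite mulr_gt0// ltr_wpDl.
move=> x /(hN _ N1) xN; rewrite /eball/= subr0.
have N10 : 0 < `|N| + 1 by rewrite ltr_wpDl.
rewrite -(@ltr_pXn2r _ 2%N)// ?nnegrE ?enorm_ge0 ?mulr_ge0 ?(ltW N10)//.
rewrite enorm_sqr; apply: (@le_lt_trans _ _ (\sum_(i < n) (`|N| + 1) ^+ 2)).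
  apply: ler_sum => i _; rewrite -real_normK ?num_real//.
  rewrite lerXn2r ?nnegrE ?normr_ge0 ?(ltW N10)// (le_trans _ xN)//.
  rewrite [leRHS]/Num.norm/= mx_normrE; apply/bigmax_geP; right => /=.
  by exists (ord0, i).
rewrite sumr_const card_ord -[X in X < _]mulr_natl exprMn ltr_pM2r ?exprn_gt0//.
by rewrite -natrX ltr_nat -mulnn (leq_trans (ltnSn n))// leq_pmulr.
Qed.

End compact.

Section kernel_morrey.
Context {R : realType} {n : nat}.
Variables (alpha gamma s t : R).
Hypotheses (halpha : 0 < alpha < n%:R) (hgamma : 0 <= gamma).
Hypotheses (s1 : 1 <= s) (t0 : 0 < t).
Hypothesis htau : n%:R - alpha <= n%:R / t <= n%:R - alpha + gamma.
Hypothesis hs : n%:R / t * s < n%:R \/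
  n%:R / t * s = n%:R /\ n%:R - alpha < n%:R / t < n%:R - alpha + gamma.
Hypothesis st : s <= t.
Implicit Types (x y a : 'rV[R]_n) (r : R).
Local Notation mu := (@lebesgue_rV R n).
Local Notation K := (bessel_riesz_kernel n alpha gamma).

Let s0 : 0 < s. Proof. exact: lt_le_trans s1. Qed.

Let normKE x : `|K x| = K x.
Proof. by rewrite ger0_norm ?bessel_riesz_kernel_ge0. Qed.

(** The exponent 1/t - 1/s is not positive, so the lower bound on the volume of balls is the one
    that counts. The powers of r cancel: n(1/t - 1/s) + (n - ns/t)/s = 0. *)
Lemma morrey_bessel_riesz_kernel : morrey s t K.
Proof.
have [A A0 hA] := @integral_eball_kernel0_le R n alpha gamma halpha hgamma
  (n%:R / t) s s0 htau hs.
split.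
  split; first exact: measurable_bessel_riesz_kernel.
  move=> C /compact_sub_eball[r r0 Cr].
  apply: (@le_lt_trans _ _ (\int[mu]_(x in eball 0 r) (K x `^ s)%:E)%E).
    by apply: ge0_le_integral_lower => // x _; rewrite ?normKE !lee_fin ?powR_ge0 ?lexx.
  by apply: le_lt_trans (hA _ _ r0) _; rewrite ltry.
pose c : R := (2 / n.+1%:R) ^+ n.
have c0 : 0 < c by rewrite exprn_gt0// divr_gt0.
have e0 : t^-1 - s^-1 <= 0 by rewrite subr_le0 lef_pV2 ?posrE.
apply: (@le_lt_trans _ _ (c `^ (t^-1 - s^-1) * A `^ s^-1)%:E); last by rewrite ltry.
apply: ge_ereal_sup => _ [a _ [r rI <-]]; move: rI; rewrite /= in_itv/= andbT => r0.
have [m mE /andP[cm _]] := lebesgue_rV_eballE a r r0.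
rewrite mE poweR_EFin; under eq_integral do rewrite normKE.
have rn : 0 < r ^+ n by rewrite exprn_gt0.
apply: (@le_trans _ _ (((c * r ^+ n) `^ (t^-1 - s^-1))%:E *
    (A * r `^ (n%:R - n%:R / t * s))%:E `^ s^-1)%E).
  apply: lee_pmul; [by rewrite lee_fin powR_ge0|exact: poweR_ge0| |].
    have m0 : 0 < m by apply: lt_le_trans cm; rewrite exprn_gt0// mulr_gt0// divr_gt0.
    rewrite lee_fin -[t^-1 - s^-1]opprK !(powRN _ (- (t^-1 - s^-1))).
    rewrite lef_pV2 ?posrE ?powR_gt0 ?mulr_gt0//.
    rewrite ge0_ler_powR ?nnegrE ?oppr_ge0 ?(ltW m0) ?mulr_ge0 ?(ltW c0) ?(ltW rn)//.
    by rewrite -exprMn.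
  have I0 : (0 <= \int[mu]_(x in eball a r) (K x `^ s)%:E)%E.
    by apply: integral_ge0 => x _; rewrite lee_fin powR_ge0.
  apply: gt0_ler_poweR; rewrite ?invr_ge0 ?(ltW s0)// ?in_itv/= ?leey ?andbT//.
    by rewrite lee_fin mulr_ge0 ?powR_ge0 ?(ltW A0).
  exact: hA.
rewrite poweR_EFin -EFinM lee_fin !powRM ?powR_ge0 ?(ltW c0) ?(ltW rn) ?(ltW A0)//.
rewrite mulrACA -[r ^+ n]powR_mulrn ?(ltW r0)// -!powRrM -powRD; last first.
  by rewrite (gt_eqF r0) implybT.
rewrite [X in r `^ X](_ : _ = 0) ?powRr0 ?mulr1//.
by field; rewrite !gt_eqF.
Qed.

(** Allows division by this norm. The unit ball about (2,...,2) stays away from the origin, where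
    the kernel is 0 by convention, so the kernel has a positive lower bound on it. *)
Lemma morrey_norm_bessel_riesz_kernel_gt0 : (0 < morrey_norm s t K)%E.
Proof.
move: (halpha) => /andP[a0 an].
have n0 : (0 < n)%N by rewrite -(ltr_nat R) (lt_trans a0).
pose a : 'rV[R]_n := const_mx 2.
have a2 : 2 <= enorm a.
  by have := ler_coord_enorm a (Ordinal n0); rewrite mxE ger0_norm.
pose L := enorm a + 1; have L0 : 0 < L by rewrite /L; lra.
pose k := L `^ (alpha - n%:R) / (1 + L) `^ gamma.
have k0 : 0 < k by rewrite divr_gt0 ?powR_gt0// addr_gt0.
have kK x : eball a 1 x -> k <= K x.
  rewrite /eball/= => xa.
  have x0 : 0 < enorm x.
    by have := ler_enormD (a - x) x; rewrite subrK enormC; lra.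
  have xL : enorm x <= L.
    by have := ler_enormD (x - a) a; rewrite subrK /L; lra.
  have x1 : 0 < 1 + enorm x by rewrite addr_gt0.
  have L1 : 0 < 1 + L by rewrite addr_gt0.
  rewrite /k /bessel_riesz_kernel ler_pM ?invr_ge0 ?powR_ge0//.
    rewrite -(opprB n%:R alpha) !powRN lef_pV2 ?posrE ?powR_gt0//.
    by rewrite ge0_ler_powR ?nnegrE ?subr_ge0 ?enorm_ge0 ?(ltW L0)// ltW.
  rewrite lef_pV2 ?posrE ?powR_gt0//.
  by rewrite ge0_ler_powR ?nnegrE ?(ltW x1) ?(ltW L1)// lerD2l.
have [m mE _] := lebesgue_rV_eballE a 1 ltr01.
have m0 := lebesgue_rV_eball_gt0 _ _ _ ltr01 mE.
apply: (@lt_le_trans _ _ (mu (eball a 1) `^ (t^-1 - s^-1) *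
    (\int[mu]_(x in eball a 1) (`|K x| `^ s)%:E) `^ s^-1)%E); last first.
  apply: ereal_sup_ubound; exists a => //; exists 1 => //=.
  by rewrite in_itv/= ltr01.
rewrite mE poweR_EFin mule_gt0 ?lte_fin ?powR_gt0//; apply: poweR_gt0.
apply: (@lt_le_trans _ _ (\int[mu]_(x in eball a 1) cst (k `^ s)%:E x)%E).
  rewrite integral_cst; last exact: measurable_eball.
  by rewrite -[X in (_ * X)%E]/(mu (eball a 1)) mE -EFinM lte_fin mulr_gt0 ?powR_gt0.
apply: ge0_le_integral_lower => // x xa; rewrite !lee_fin ?powR_ge0//= normKE.
by rewrite ge0_ler_powR ?nnegrE ?bessel_riesz_kernel_ge0 ?(ltW s0) ?(ltW k0) ?kK.
Qed.

End kernel_morrey.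

(** * Measurability of the potential *)

Section measurability.
Context {R : realType} {n : nat}.

(** [Rintegral] is [fine] of the difference of the integrals of the positive and negative parts,
    each measurable in [x] by Tonelli. The argument includes the points where the integral
    diverges. *)
Lemma measurable_bessel_riesz (alpha gamma : R) (f : 'rV[R]_n -> R) :
  measurable_fun setT f -> measurable_fun setT (bessel_riesz alpha gamma f).
Proof.
move=> mf.
have mg : measurable_fun setT (fun z : 'rV[R]_n * 'rV[R]_n =>
    (bessel_riesz_integrand alpha gamma f z.1 z.2)%:E).
  apply: (measurable_EFinP _ _).2; apply: measurable_funM; last exact: measurableT_comp.
  apply: measurableT_comp; first exact: measurable_bessel_riesz_kernel.
  by apply: measurable_rV_sub; [exact: measurable_fst|exact: measurable_snd].
apply: (measurableT_comp (fine_measurable measurableT)).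
under [X in measurable_fun _ X]eq_fun do rewrite integralE.
apply: emeasurable_funB.
- have := @measurable_fun_integral_set _ _ _ _ _ (lebesgue_rV n) setT _ measurableT
    (measurable_funepos mg) (funepos_ge0 _).
  by congr measurable_fun; apply/funext => x; apply: eq_integral => y _; rewrite !funeposE.
- have := @measurable_fun_integral_set _ _ _ _ _ (lebesgue_rV n) setT _ measurableT
    (measurable_funeneg mg) (funeneg_ge0 _).
  by congr measurable_fun; apply/funext => x; apply: eq_integral => y _; rewrite !funenegE.
Qed.

End measurability.

(** The first conjunct gives content to the others: it ensures that at almost every point the norm
    of the image measures true integrals and not default values of [Rintegral]. *)
Theorem theorem2p3 (R : realType) (n : nat) (alpha gamma p1 p2 s t : R)
    (phi psi : R -> R)
    (halpha : 0 < alpha < n%:R)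
    (hgamma : 0 <= gamma)
    (hp1 : 1 <= p1 < n%:R / alpha)
    (hst : (1 <= s < t /\ t = n%:R / (n%:R - alpha)) \/
           [/\ 0 < gamma, 1 <= s <= t
             & n%:R / (n%:R + gamma - alpha) < t < n%:R / (n%:R - alpha)])
    (hp2 : p2^-1 = p1^-1 - inv_dual s)
    (hphi : class_G n p1 phi)
    (hint : exists2 C0 : R, 0 < C0 & forall R0 : R, 0 < R0 ->
      (\int[lebesgue_measure]_(r in `]R0, +oo[)
          (phi r * r `^ (n%:R * inv_dual t - 1))%:E
        <= (C0 * phi R0 * R0 `^ (n%:R * inv_dual t))%:E)%E)
    (hpsi : forall r : R, 0 < r -> psi r = phi r * r `^ (n%:R * inv_dual t)) :
  [/\ forall f : 'rV[R]_n -> R, gmorrey p1 phi f ->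
        bessel_riesz_defined alpha gamma f,
      bounded_operator (n := n) (bessel_riesz alpha gamma)
        (gmorrey p1 phi) (gmorrey_norm p1 phi)
        (gmorrey p2 psi) (gmorrey_norm p2 psi),
      morrey s t (bessel_riesz_kernel n alpha gamma)
    & exists2 C : R, 0 < C & forall f : 'rV[R]_n -> R, gmorrey p1 phi f ->
        (gmorrey_norm p2 psi (bessel_riesz alpha gamma f) <=
         C%:E * morrey_norm s t (bessel_riesz_kernel n alpha gamma) *
         gmorrey_norm p1 phi f)%E].
Proof.
move: (halpha) (hp1) => /andP[a0 an] /andP[p11 p1n].
have n0 : 0 < n%:R :> R by exact: lt_trans an.
have na0 : 0 < n%:R - alpha by rewrite subr_gt0.
have s1 : 1 <= s by case: hst => [[/andP[]]|[_ /andP[]]].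
have s0 : 0 < s by exact: lt_le_trans s1.
have st : s <= t by case: hst => [[/andP[_ /ltW]]|[_ /andP[]]].
have t1 : 1 <= t by exact: le_trans st.
have t0 : 0 < t by exact: lt_le_trans t1.
have p10 : 0 < p1 by exact: lt_le_trans p11.
set tau := n%:R / t.
have taun : tau <= n%:R by rewrite ler_pdivrMr// ler_peMr// ltW.
have tauE : n%:R * inv_dual t = n%:R - tau by rewrite inv_dualE// mulrBr mulr1.
(* Assumption (a) says tau = n - alpha, and the strict inequality s < t is kept for the
   integrability of the power; (b) says that tau is strictly inside the interval. *)
have htau2 : (t = n%:R / (n%:R - alpha) /\ s < t) \/
    n%:R - alpha < tau < n%:R - alpha + gamma.
  case: hst => [[/andP[_ ?] ?]|[g0 _ /andP[h1 h2]]]; first by left.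
  right; apply/andP; split.
    by rewrite ltr_pdivlMr// mulrC -ltr_pdivlMr.
  rewrite ltr_pdivrMr// mulrC -ltr_pdivrMr; last by lra.
  by rewrite (_ : n%:R - alpha + gamma = n%:R + gamma - alpha)//; ring.
have htau : n%:R - alpha <= tau <= n%:R - alpha + gamma.
  case: htau2 => [[tE _]|/andP[/ltW -> /ltW ->]]//.
  by rewrite /tau tE invf_div mulrC divfK ?gt_eqF// lexx lerDl.
have hs : tau * s < n%:R \/
    tau * s = n%:R /\ n%:R - alpha < tau < n%:R - alpha + gamma.
  have [stlt|] := ltP s t.
    by left; rewrite /tau mulrAC ltr_pdivrMr// ltr_pM2l.
  move=> ts; case: htau2 => [[_ /(le_lt_trans ts)]|h]; first by rewrite ltxx.
  right; split => //; have -> : s = t by apply/le_anti/andP.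
  by rewrite divfK ?gt_eqF.
have qE : p2^-1 = p1^-1 + s^-1 - 1 by rewrite hp2 inv_dualE//; ring.
(* 1/p1 > alpha/n because p1 < n/alpha, and 1/s >= 1/t = tau/n >= 1 - alpha/n. *)
have p20 : 0 < p2.
  rewrite -invr_gt0 qE.
  have p1a : alpha / n%:R < p1^-1.
    by rewrite -[_ / _]invf_div ltf_pV2 ?posrE ?divr_gt0.
  have ts : tau / n%:R <= s^-1.
    by rewrite /tau mulrAC divff ?gt_eqF// mul1r lef_pV2 ?posrE.
  have : (n%:R - alpha) / n%:R <= tau / n%:R.
    by rewrite ler_pM2r ?invr_gt0//; case/andP: htau.
  by rewrite mulrBl divff ?gt_eqF//; lra.
have [phi0 [Cd Cd0 phi_decr] _] := hphi.
have [C0 C00 hint0] := hint.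
have psi0 r : 0 < r -> 0 < psi r by move=> r0; rewrite hpsi// mulr_gt0 ?powR_gt0 ?phi0.
have [A A0 hA] := @integral_eball_kernel_le R n alpha gamma halpha hgamma tau s s0 htau hs.
have Cs0 : 0 < 2 / Cd * C0 by rewrite mulr_gt0// divr_gt0.
have phi_sum r k : 0 < r ->
    \sum_(i < k) phi (2 ^+ i.+1 * r) * (2 ^+ i * r) `^ (n%:R - tau) <=
    2 / Cd * C0 * (phi r * r `^ (n%:R - tau)).
  move=> r0; apply: sum_dyadic_le => //; first by rewrite subr_ge0.
  by have := hint0 r r0; rewrite tauE.
have [M M0 hM] := @bessel_riesz_le R n alpha gamma p1 p2 s tau A Cd _ phi halpha
  hgamma p11 s1 p20 qE htau taun A0 hA phi0 Cd0 phi_decr Cs0 phi_sum.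
have norm_ge0 (f : 'rV[R]_n -> R) : (0 <= gmorrey_norm p1 phi f)%E.
  apply: le_trans (ereal_sup_ubound _); last first.
    by exists 0 => //; exists 1 => //=; rewrite in_itv/= ltr01.
  by rewrite mule_ge0 ?poweR_ge0// lee_fin invr_ge0 ltW ?phi0.
have norm_le (f : 'rV[R]_n -> R) : gmorrey p1 phi f ->
    exists2 N, gmorrey_norm p1 phi f = N%:E & 0 <= N.
  move=> [_]; have := norm_ge0 f.
  by case: (gmorrey_norm _ _ _) => [N| |]//; exists N.
have defined (f : 'rV[R]_n -> R) : gmorrey p1 phi f -> bessel_riesz_defined alpha gamma f.
  move=> fm; have [N NE N0] := norm_le f fm.
  have N1 : 0 < N + 1 by rewrite ltr_wpDl.
  have [//|//|//] := hM f (N + 1) N1.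
  - by case: fm => [[]].
  - apply/gmorrey_norm_leP => //; first exact: ltW.
    by rewrite NE lee_fin lerDl.
have bounded (f : 'rV[R]_n -> R) : gmorrey p1 phi f ->
    (gmorrey_norm p2 psi (bessel_riesz alpha gamma f) <= M%:E * gmorrey_norm p1 phi f)%E.
  move=> fm; have [N NE N0] := norm_le f fm.
  rewrite NE -EFinM; apply/lee_addgt0Pr => e e0.
  (* The norm [N] may be 0 while [hM] wants a positive bound; the slack e/M costs exactly e in the
     conclusion. *)
  have N'0 : 0 < N + e / M by rewrite ltr_wpDl// divr_gt0.
  have [||_ h] := hM f (N + e / M) N'0.
  - by case: fm => [[]].
  - apply/gmorrey_norm_leP => //; first exact: ltW.
    by rewrite NE lee_fin lerDl divr_ge0 ?ltW.
  rewrite -EFinD; have -> : M * N + e = M * (N + e / M) by field; rewrite gt_eqF.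
  apply/gmorrey_norm_leP => //; first by rewrite ltW ?mulr_gt0.
  by move=> a r r0; rewrite hpsi// tauE; exact: h.
have MK := @morrey_bessel_riesz_kernel R n alpha gamma s t halpha hgamma s1 t0 htau hs st.
split => //.
- exists M => // f fm; split; last exact: bounded.
  have [N NE N0] := norm_le f fm.
  have Tfin : (gmorrey_norm p2 psi (bessel_riesz alpha gamma f) <= (M * N)%:E)%E.
    by rewrite EFinM -NE; exact: bounded.
  split; last by apply: le_lt_trans Tfin _; rewrite ltry.
  split; first by apply: measurable_bessel_riesz; case: fm => [[]].
  move=> C /compact_sub_eball[r r0 Cr].
  have hT := (gmorrey_norm_leP _ _ _ _ p20 psi0 (mulr_ge0 (ltW M0) N0)).1 Tfin 0 r r0.
  have [m mE _] := lebesgue_rV_eballE (0 : 'rV[R]_n) r r0; rewrite mE -EFinM in hT.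
  apply: le_lt_trans (le_trans (ge0_le_integral_lower _ _ _ _ _ _ _ _ Cr _ _) hT) (ltry _).
    by move=> x _; rewrite lee_fin powR_ge0.
  by move=> x _; rewrite lee_fin powR_ge0 lexx.
- have := @morrey_norm_bessel_riesz_kernel_gt0 R n alpha gamma s t halpha hgamma s1.
  case: MK => _; case: (morrey_norm _ _ _) => [k| |]// _ k0.
  rewrite lte_fin in k0.
  exists (M / k); first by rewrite divr_gt0.
  by move=> f fm; rewrite -EFinM divfK ?gt_eqF//; exact: bounded.
Qed.
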